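(* Let $\mathbf A_N^{(1)},\dots,\mathbf A_N^{(L)}$ be independent families of $N\times N$ random matrices, $\mathbf A_N^{(\ell)}=(A_j^{(\ell)})_{j\in J_\ell}$, with associated pairwise distinct variables $\mathbf x_\ell=(x_j^{(\ell)})_{j\in J_\ell}$. Assume: (1) Each family, except possibly one, is permutation invariant. (2) Each family converges in traffic distribution: for any $\ell=1,\dots,L$ and any $*$-graph polynomial $g$ in the variables $\mathbf x_\ell$, the limit $\bar\Phi_\ell(g):=\lim_{N\to\infty}\mathbb E\big[\frac1N\mathrm{Tr}\,[g(\mathbf A_N^{(\ell)})]\big]$ exists. (3) Each family satisfies the factorization property: for all $\ell=1,\dots,L$, all $K\ge 2$ and all $*$-graph polynomials $g_1,\dots,g_K$ in the variables $\mathbf x_\ell$, $$\mathbb E\Big[\prod_{k=1}^K\frac1N\mathrm{Tr}\,[g_k(\mathbf A_N^{(\ell)})]\Big]\longrightarrow_{N\to\infty}\prod_{k=1}^K\bar\Phi_\ell(g_k).$$ Then $\mathbf A_N^{(1)},\dots,\mathbf A_N^{(L)}$ are asymptotically traffic independent, that is: (1) They have a limiting joint traffic distribution: for any $*$-graph polynomial $g$ in the variables $\mathbf x_1\cup\dots\cup\mathbf x_L$, the limit $\bar\Phi(g):=\lim_{N\to\infty}\mathbb E\big[\frac1N\mathrm{Tr}\,[g(\mathbf A_N^{(1)},\dots,\mathbf A_N^{(L)})]\big]$ exists. In particular $\mathbf A_N=\mathbf A_N^{(1)}\cup\dots\cup\mathbf A_N^{(L)}$ has a limiting joint $*$-distribution.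 (2) The limiting traffic distribution of $\mathbf A_N$ depends only on the marginal limiting traffic distributions $\bar\Phi_\ell$ of the $\mathbf A_N^{(\ell)}$: it is their product. Namely, with $\tau^0[T]:=\lim_{N\to\infty}\tau_N^0[T(\mathbf A_N)]$, for every $*$-test graph $T$ in the variables $\mathbf x_1\cup\dots\cup\mathbf x_L$, $$\tau^0[T]=\mathbf 1\big(\mathcal{GCC}(T)\text{ is a tree}\big)\prod_{S\in\mathcal{CC}(T)}\tau^0[S].$$ Moreover, the family $\mathbf A_N$ also satisfies the factorization property.
   Context: All random matrices are complex, with entries having finite moments of all orders; $\mathbf A_N$ stands for a sequence in $N$. $[N]=\{1,\dots,N\}$. A family is permutation invariant if $(A_j)_j$ has the same joint law as $(VA_jV^* )_j$ for every permutation matrix $V$. Graphs. A directed graph $(V,E)$ has a nonempty vertex set $V$ and a multiset $E$ of ordered pairs of vertices ($e=(v,w)$ goes from source $v$ to target $w$); loops, multiple edges and $E=\emptyset$ are allowed. A $*$-test graph in variables $\mathbf x=(x_j)_{j\in J}$ is $T=(V,E,\gamma,\varepsilon)$ where $(V,E)$ is a finite connected directed graph, $\gamma:E\to J$, $\varepsilon:E\to\{1,*\}$ (edge $e$ has label $x_{\gamma(e)}^{\varepsilon(e)}$), up to isomorphism. A $*$-graph monomial is $g=(T,in,out)$ with $T$ a $*$-test graph and $in,out\in V$, possibly equal; $*$-graph polynomials are finite complex linear combinations of $*$-graph monomials. Evaluation. For a family $\mathbf A_N=(A_j)_{j\in J}$ of $N\times N$ matrices, $g(\mathbf A_N)$ is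 the matrix with entries $$g(\mathbf A_N)(i,k)=\sum_{\phi:V\to[N],\,\phi(out)=i,\,\phi(in)=k}\ \prod_{e=(v,w)\in E}A_{\gamma(e)}^{\varepsilon(e)}(\phi(w),\phi(v)),$$ extended linearly to $*$-graph polynomials ($A^*$ is the conjugate transpose). For a $*$-test graph $T$, $\tau_N^0[T(\mathbf A_N)]=\mathbb E\big[\frac1N\sum_{\phi:V\to[N]\text{ injective}}\prod_{e=(v,w)\in E}A_{\gamma(e)}^{\varepsilon(e)}(\phi(w),\phi(v))\big]$. Pointwise convergence of $g\mapsto\mathbb E[\frac1N\mathrm{Tr}\,g(\mathbf A_N)]$ is equivalent to pointwise convergence of $T\mapsto\tau_N^0[T(\mathbf A_N)]$. Colored components. A colored component of $T$ with respect to $\mathbf x_1,\dots,\mathbf x_L$ is a maximal connected subgraph with at least one edge, all of whose edges are labeled by variables (or their adjoints) from a single family $\mathbf x_\ell$; $\mathcal{CC}(T)$ is their set. $\mathcal{GCC}(T)$ is the undirected bipartite graph whose vertices are the colored components of $T$ together with the vertices of $T$ belonging to at least two colored components, with an edge between a component and such a vertex whenever the vertex belongs to the component. (For the graph with no edge, $\tau^0=1$.) The $*$-distribution of $\mathbf A_N$ is $P\mapsto\mathbb E[\frac1N\mathrm{Tr}\,P(\mathbf A_N)]$ on polynomials $P$ in noncommuting variables $\mathbf x,\mathbf x^*$. *)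

(* Defs.v *)
From mathcomp Require Export all_boot all_order all_fingroup all_algebra.
From mathcomp Require Export all_classical all_reals all_analysis.
From mathcomp Require Export complex.

Set Implicit Arguments.
Unset Strict Implicit.
Unset Printing Implicit Defensive.

Import Order.TTheory GRing.Theory Num.Theory.
Import numFieldNormedType.Exports.

Local Open Scope classical_set_scope.
Local Open Scope ring_scope.
Local Open Scope sesquilinear_scope.
Local Open Scope complex_scope.

(* Graphs labeled by [x_k] ([star e = false]) or [x_k^*] ([star e = true]),
   [k : K].  Connectedness is kept separate, see [connected]. *)
Record lgraph (K : Type) := LGraph {
  vert : finType;
  edge : finType;
  src : edge -> vert;
  tgt : edge -> vert;
  lab : edge -> K;
  star : edge -> bool }.

Section Graphs.
Variable K : Type.
Implicit Type T : lgraph K.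

Definition adjacent T : rel (vert T) := fun u v =>
  [exists e : edge T, ((src e == u) && (tgt e == v)) ||
                      ((src e == v) && (tgt e == u))].

Definition connected T : bool :=
  (0 < #|vert T|)%N && [forall u, forall v, connect (@adjacent T) u v].

Record star_test_graph := StarTestGraph {
  tg_graph :> lgraph K;
  tg_connected : connected tg_graph }.

Record gmonomial := GMonomial {
  gm_graph :> star_test_graph;
  gm_in : vert gm_graph;
  gm_out : vert gm_graph }.

Definition subgraph_closed T (S : {set vert T} * {set edge T}) : bool :=
  [forall e in S.2, (src e \in S.1) && (tgt e \in S.1)].

Definition subgraph T :=
  {S : {set vert T} * {set edge T} | subgraph_closed S}.

Definition subV T (S : subgraph T) : {set vert T} := (val S).1.
Definition subE T (S : subgraph T) : {set edge T} := (val S).2.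

Definition sub_le T (S S' : subgraph T) : bool :=
  (subV S \subset subV S') && (subE S \subset subE S').

Lemma sub_src T (S : subgraph T) (e : {e | e \in subE S}) :
  src (val e) \in subV S.
Proof. by have /forall_inP/(_ _ (valP e))/andP[] := valP S. Qed.

Lemma sub_tgt T (S : subgraph T) (e : {e | e \in subE S}) :
  tgt (val e) \in subV S.
Proof. by have /forall_inP/(_ _ (valP e))/andP[] := valP S. Qed.

Definition sub_lgraph T (S : subgraph T) : lgraph K :=
  @LGraph K {v | v \in subV S} {e | e \in subE S}
    (fun e => exist _ (src (val e)) (sub_src e))
    (fun e => exist _ (tgt (val e)) (sub_tgt e))
    (fun e => lab (val e)) (fun e => star (val e)).

End Graphs.

Definition relabel (K K' : Type) (f : K -> K') (T : lgraph K) : lgraph K' :=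
  @LGraph K' (vert T) (edge T) (@src _ T) (@tgt _ T) (f \o @lab _ T)
    (@star _ T).

Definition relabel_test (K K' : Type) (f : K -> K') (T : star_test_graph K) :
    star_test_graph K' :=
  @StarTestGraph K' (relabel f T) (tg_connected T).

(* A variable of the union of the families is a pair (l, j) with j : J l;
   its color is l. *)
Section ColoredComponents.
Variables (L : nat) (J : 'I_L -> Type) (T : lgraph {l : 'I_L & J l}).

Definition monochromatic (S : subgraph T) : bool :=
  [exists l : 'I_L, forall e in subE S, tag (lab e) == l].

Definition colored_subgraph (S : subgraph T) : bool :=
  [&& connected (sub_lgraph S), subE S != finset.set0 & monochromatic S].

Definition CC : {set subgraph T} :=
  [set S | colored_subgraph S &
     [forall S' : subgraph T,
        (colored_subgraph S' && sub_le S S') ==> (S' == S)]]%SET.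

Definition shared (v : vert T) : bool :=
  (2 <= #|[set S in CC | v \in subV S]%SET|)%N.

Definition GCC_vertex : finType :=
  ({S : subgraph T | S \in CC} + {v : vert T | shared v})%type.

Definition GCC : rel GCC_vertex := fun a b =>
  match a, b with
  | inl H, inr v | inr v, inl H => val v \in subV (val H)
  | _, _ => false
  end.

Lemma CC_connected (S : subgraph T) : S \in CC -> connected (sub_lgraph S).
Proof. by rewrite finset.inE => /andP[/and3P[]]. Qed.

Definition CC_test_graph (S : {S : subgraph T | S \in CC}) :
    star_test_graph {l : 'I_L & J l} :=
  StarTestGraph (CC_connected (valP S)).

End ColoredComponents.

(* Connected and acyclic, for a simple undirected graph given by a symmetric
   irreflexive relation.  [ucycle e p] with [size p = 2] is an edge run back
   and forth, hence the bound 2.  The empty graph counts as a tree, so that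
   the edgeless test graph, whose GCC is empty, gets the value 1. *)
Definition is_tree (V : finType) (e : rel V) : Prop :=
  (forall u v : V, connect e u v) /\
  (forall p : seq V, ucycle e p -> (size p <= 2)%N).

Section Evaluation.
Variables (R : realType) (K : Type) (N : nat).
Implicit Type A : K -> 'M[R[i]]_N.

Definition mx_star (b : bool) (M : 'M[R[i]]_N) : 'M[R[i]]_N :=
  if b then M ^t* else M.

Definition weight A (T : lgraph K) (phi : {ffun vert T -> 'I_N}) : R[i] :=
  \prod_(e : edge T) mx_star (star e) (A (lab e)) (phi (tgt e)) (phi (src e)).

Definition gm_eval A (g : gmonomial K) : 'M[R[i]]_N :=
  \matrix_(i, k) \sum_(phi : {ffun vert g -> 'I_N} |
      (phi (gm_out g) == i) && (phi (gm_in g) == k)) weight A phi.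

Definition ntr (M : 'M[R[i]]_N) : R[i] := N%:R^-1 * \tr M.

Definition inj_trace A (T : lgraph K) : R[i] :=
  N%:R^-1 * \sum_(phi : {ffun vert T -> 'I_N} | injectiveb phi) weight A phi.

End Evaluation.

(* Formal finite linear combinations, [(c, g)] standing for [c g]. *)
Definition gpoly (R : realType) (K : Type) := seq (R[i] * gmonomial K).

Definition gp_eval (R : realType) (K : Type) (N : nat)
    (A : K -> 'M[R[i]]_N) (g : gpoly R K) : 'M[R[i]]_N :=
  \sum_(t <- g) t.1 *: gm_eval A t.2.

(* Noncommutative *-polynomials: formal finite linear combinations of words;
   the letter [(k, b)] is [x_k] if [b = false] and [x_k^*] if [b = true]. *)
Definition ncpoly (R : realType) (K : Type) := seq (R[i] * seq (K * bool)).

Definition nc_eval (R : realType) (K : Type) (N : nat)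
    (A : K -> 'M[R[i]]_N) (p : ncpoly R K) : 'M[R[i]]_N :=
  \sum_(t <- p) t.1 *: \big[mulmx/1%:M]_(x <- t.2) mx_star x.2 (A x.1).

Section RandomFamilies.
Context (R : realType) (d : measure_display) (Omega : measurableType d)
  (P : probability Omega R).

Definition cexpect (X : Omega -> R[i]) : R[i] :=
  fine ('E_P[fun w => complex.Re (X w)])%E +i*
  fine ('E_P[fun w => complex.Im (X w)])%E.

Definition crandom (X : Omega -> R[i]) : Prop :=
  measurable_fun [set: Omega] (fun w => complex.Re (X w)) /\
  measurable_fun [set: Omega] (fun w => complex.Im (X w)).

Definition finite_moments (X : Omega -> R[i]) : Prop :=
  forall p : nat, ('E_P[fun w => (complex.Re `|X w| ^+ p)%R] < +oo)%E.

Definition random_family (K : Type) (N : nat)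
    (A : Omega -> K -> 'M[R[i]]_N) : Prop :=
  forall (k : K) (i j : 'I_N),
    crandom (fun w => A w k i j) /\ finite_moments (fun w => A w k i j).

(* Generators of the product sigma-algebra on families of complex matrices. *)
Definition family_cylinder (K : Type) (N : nat) :
    set (set (K -> 'M[R[i]]_N)) :=
  [set C | exists (k : K) (i j : 'I_N) (B : set R), measurable B /\
     (C = [set F : K -> 'M[R[i]]_N | B (complex.Re (F k i j))] \/
      C = [set F : K -> 'M[R[i]]_N | B (complex.Im (F k i j))])].

Definition family_event (K : Type) (N : nat) : set (set (K -> 'M[R[i]]_N)) :=
  <<s @family_cylinder K N >>.

Definition same_law (K : Type) (N : nat)
    (A A' : Omega -> K -> 'M[R[i]]_N) : Prop :=
  forall B, @family_event K N B -> P (A @^-1` B) = P (A' @^-1` B).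

Definition perm_invariant (K : Type) (N : nat)
    (A : Omega -> K -> 'M[R[i]]_N) : Prop :=
  forall s : 'S_N,
    same_law A (fun w k => perm_mx s *m A w k *m (perm_mx s) ^t*).

Definition independent_families (L : nat) (J : 'I_L -> Type) (N : nat)
    (A : forall l : 'I_L, Omega -> J l -> 'M[R[i]]_N) : Prop :=
  forall B : forall l : 'I_L, set (J l -> 'M[R[i]]_N),
    (forall l, @family_event (J l) N (B l)) ->
    P (\bigcap_(l in [set: 'I_L]) (A l @^-1` B l)) =
    (\prod_(l < L) P (A l @^-1` B l))%E.

End RandomFamilies.

Section Asymptotics.
Context (R : realType) (d : nat -> measure_display)
  (Omega : forall N, measurableType (d N))
  (P : forall N, probability (Omega N) R).

(* [R[i]^o] carries the topology of the modulus on [R[i]]. *)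
Definition ccvg (u : nat -> R[i]) (l : R[i]) : Prop :=
  (u : nat -> R[i]^o) @ \oo --> (l : R[i]^o).

Variables (K : Type) (A : forall N, Omega N -> K -> 'M[R[i]]_N).
Arguments A : clear implicits.

Definition tauN0 (T : star_test_graph K) (N : nat) : R[i] :=
  cexpect (P N) (fun w => inj_trace (A N w) T).

Definition cvg_traffic (Phi : gpoly R K -> R[i]) : Prop :=
  forall g : gpoly R K,
    ccvg (fun N => cexpect (P N) (fun w => ntr (gp_eval (A N w) g))) (Phi g).

Definition factorization (Phi : gpoly R K -> R[i]) : Prop :=
  forall (k : nat) (g : 'I_k -> gpoly R K), (2 <= k)%N ->
    ccvg (fun N => cexpect (P N) (fun w =>
            \prod_(r < k) ntr (gp_eval (A N w) (g r))))
         (\prod_(r < k) Phi (g r)).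

Definition cvg_star_distribution : Prop :=
  forall p : ncpoly R K, exists l : R[i],
    ccvg (fun N => cexpect (P N) (fun w => ntr (nc_eval (A N w) p))) l.

End Asymptotics.

Definition union_family (R : realType) (Omega : Type) (L : nat)
    (J : 'I_L -> Type) (N : nat)
    (A : forall l : 'I_L, Omega -> J l -> 'M[R[i]]_N) :
    Omega -> {l : 'I_L & J l} -> 'M[R[i]]_N :=
  fun w x => A (tag x) w (tagged x).

(* Main.v *)
From HB Require Import structures.
Require Import Defs.
From mathcomp Require Import measurable_realfun.
From mathcomp Require Import zify ring lra.

Set Implicit Arguments.
Unset Strict Implicit.
Unset Printing Implicit Defensive.

Import Order.TTheory GRing.Theory Num.Theory.
Import numFieldNormedType.Exports.

Local Open Scope classical_set_scope.
Local Open Scope ring_scope.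
Local Open Scope sesquilinear_scope.
Local Open Scope complex_scope.

(** Everything is read off the means of injective sums.  For a graph [T] with
    [n] vertices, [inj_sum A T] is the sum of the weights over the injective
    maps from the vertices to [N] points, and [T_l] is the spanning subgraph of
    [T] formed by the edges of color [l].

    Exact formula.  For one injective map, independence splits the mean of the
    weight into one factor per color.  Any two injective maps differ by a
    permutation of the [N] points, so the factor of a permutation invariant
    family does not depend on the map.  As this applies to all colors but one,
    summing over the maps gives
    [(N ^_ n) ^ (L - 1) * E (inj_sum T) = prod_l E (inj_sum T_l)]
    (lemma [cexpect_inj_sum_colors]).

    One color.  By Moebius inversion over the partitions of the vertices, an
    injective trace is the trace of a graph polynomial ([inj_trace_gpoly]), so
    the factorization property also holds for injective traces.  The product of
    the injective sums of the components of [T_l] is [inj_sum T_l] plus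
    injective sums of graphs in which vertices of different components are
    merged.  Those graphs have fewer components, hence a smaller order
    ([prod_vs_inj]).  By induction on the number of vertices,
    [E (inj_sum T_l) / N ^ c_l] converges, where [c_l] is the number of
    components of [T_l], isolated vertices included, to the product of the
    limits attached to the components ([scaled_mean_components]).

    All colors.  If [T] has [c] components, the two facts show that
    [E (inj_sum T) / N ^ c] is at most of order [N ^ (- x)], where
    [x = n * (L - 1) + c - sum_l c_l] ([scaled_mean_limit]).  Link every vertex
    of [T] to the components of the [T_l] that contain it: this bipartite graph
    has [n + sum_l c_l] vertices and [n * L] edges, and as many connected
    components as [T].  Therefore [x >= 0], and for a connected [T] the limit
    survives exactly when the bipartite graph is a tree.  Up to leaves, it is
    the graph of colored components ([excess_is_tree]).

    Factorization.  The product of the injective traces of several connected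
    graphs is governed by their disjoint union, again up to graphs with fewer
    components.  Since [x] is additive over disjoint unions, its vanishing is
    decided graph by graph and the limit is multiplicative
    ([cvg_prod_inj_trace]).  Every trace of a graph polynomial is a combination
    of injective traces ([gp_inj_trace]) and every word is a graph monomial
    ([word_monomial]), which transfers the result to the statements on graph
    polynomials and on the *-distribution. *)

(** * Complex random variables with finite moments *)

Section CRandom.
Context (R : realType) (d : measure_display) (Omega : measurableType d).
Implicit Types X Y : Omega -> R[i].

Lemma ReM (x y : R[i]) : complex.Re (x * y) =
  complex.Re x * complex.Re y - complex.Im x * complex.Im y.
Proof. by case: x; case: y. Qed.

Lemma ImM (x y : R[i]) : complex.Im (x * y) =
  complex.Re x * complex.Im y + complex.Im x * complex.Re y.
Proof. by case: x; case: y. Qed.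

Lemma crandom_cst (c : R[i]) : crandom (fun _ : Omega => c).
Proof. by split; exact: measurable_cst. Qed.

Lemma crandomM X Y : crandom X -> crandom Y -> crandom (fun w => X w * Y w).
Proof.
move=> [X1 X2] [Y1 Y2]; split.
  under eq_fun do rewrite ReM.
  by apply: measurable_funB; apply: measurable_funM.
under eq_fun do rewrite ImM.
by apply: measurable_funD; apply: measurable_funM.
Qed.

Lemma ReJ (x : R[i]) : complex.Re (Num.conj x) = complex.Re x.
Proof. by case: x. Qed.

Lemma ImJ (x : R[i]) : complex.Im (Num.conj x) = - complex.Im x.
Proof. by case: x. Qed.

Lemma crandomJ X : crandom X -> crandom (fun w => Num.conj (X w)).
Proof.
move=> [X1 X2]; split; first by under eq_fun do rewrite ReJ.
by under eq_fun do rewrite ImJ; exact: measurableT_comp.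
Qed.

Lemma crandom_prod (I : Type) (r : seq I) (Q : pred I) (X : I -> Omega -> R[i]) :
  (forall i, crandom (X i)) -> crandom (fun w => \prod_(i <- r | Q i) X i w).
Proof.
move=> rX; elim: r => [|a r IH].
  rewrite [X in crandom X](_ : _ = fun=> 1); first exact: crandom_cst.
  by apply/funext => w; rewrite big_nil.
rewrite [X in crandom X](_ : _ = fun w =>
    if Q a then X a w * \prod_(i <- r | Q i) X i w else \prod_(i <- r | Q i) X i w).
  by case: (Q a) => //; exact: crandomM.
by apply/funext => w; rewrite big_cons.
Qed.

End CRandom.

Section Moments.
Context (R : realType) (d : measure_display) (Omega : measurableType d)
  (P : probability Omega R).
Implicit Types X Y : Omega -> R[i].

(** Unlike integrability, this property is stable under products; the entries of
    the random matrices have it. *)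
Definition tame X := crandom X /\ finite_moments P X.

Definition cintegrable X :=
  P.-integrable [set: Omega] (fun w => (complex.Re (X w))%:E) /\
  P.-integrable [set: Omega] (fun w => (complex.Im (X w))%:E).

Definition modulus X : Omega -> R := fun w => complex.Re `|X w|.

Lemma modulusE X w : modulus X w =
  Num.sqrt (complex.Re (X w) ^+ 2 + complex.Im (X w) ^+ 2).
Proof. by rewrite /modulus; case: (X w). Qed.

Lemma modulus_ge0 X w : 0 <= modulus X w.
Proof. by rewrite modulusE sqrtr_ge0. Qed.

Lemma modulusM X Y w : modulus (fun w => X w * Y w) w = modulus X w * modulus Y w.
Proof.
by rewrite /modulus normrM ReM !normc_def /= mul0r subr0.
Qed.

Lemma measurable_modulus X : crandom X -> measurable_fun setT (modulus X).
Proof.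
move=> [X1 X2].
rewrite (funext (modulusE X)).
apply: (@measurableT_comp _ _ _ _ _ _ (@Num.sqrt R)).
  exact: (continuous_measurable_fun (@sqrt_continuous R)).
by apply: measurable_funD; apply: measurable_funX.
Qed.

Lemma tame_cst (c : R[i]) : tame (fun=> c).
Proof.
split; first exact: crandom_cst.
move=> p; rewrite expectation_cst; exact: ltry.
Qed.

(** From [(a * b) ^ p <= a ^ (2 * p) + b ^ (2 * p)]. *)
Lemma tameM X Y : tame X -> tame Y -> tame (fun w => X w * Y w).
Proof.
move=> [rX mX] [rY mY]; split; first exact: crandomM.
move=> p.
have mf Z q : crandom Z -> measurable_fun setT (fun w => (modulus Z w ^+ q)%:E).
  by move=> rZ; apply/measurable_EFinP; apply: measurable_funX; exact: measurable_modulus.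
have m0 Z q w : (0 <= (modulus Z w ^+ q)%:E)%E by rewrite lee_fin exprn_ge0 // modulus_ge0.
apply: (@le_lt_trans _ _ (\int[P]_w ((modulus X w ^+ (p * 2))%:E + (modulus Y w ^+ (p * 2))%:E))%E).
  rewrite unlock; apply: ge0_le_integral => //.
  - by move=> w _; apply: m0 (fun w => X w * Y w) p w.
  - exact: mf (crandomM rX rY).
  - by apply: emeasurable_funD; exact: mf.
  - move=> w _.
    rewrite -/(modulus (fun w => X w * Y w) w) modulusM -EFinD lee_fin exprMn !exprM.
    set a := _ ^+ p; set b := _ ^+ p.
    have : 0 <= (a - b) ^+ 2 by exact: sqr_ge0.
    have : 0 <= (a + b) ^+ 2 by exact: sqr_ge0.
    have : 0 <= a * b by rewrite mulr_ge0 // exprn_ge0 // modulus_ge0.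
    by nra.
rewrite ge0_integralD //; try by move=> w _; exact: m0.
- by apply: lte_add_pinfty; [have := mX (p*2)%N | have := mY (p*2)%N]; rewrite unlock.
- exact: mf.
- exact: mf.
Qed.

Lemma tameJ X : tame X -> tame (fun w => Num.conj (X w)).
Proof.
move=> [rX mX]; split; first exact: crandomJ.
move=> p; apply: le_lt_trans (mX p); rewrite le_eqVlt; apply/orP; left; apply/eqP.
by congr (expectation P _); apply/funext => w; rewrite norm_conjC.
Qed.

Lemma tame_prod (I : Type) (r : seq I) (Q : pred I) (X : I -> Omega -> R[i]) :
  (forall i, tame (X i)) -> tame (fun w => \prod_(i <- r | Q i) X i w).
Proof.
move=> rX; elim: r => [|a r IH].
  rewrite [X in tame X](_ : _ = fun=> 1); first exact: tame_cst.
  by apply/funext => w; rewrite big_nil.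
rewrite [X in tame X](_ : _ = fun w =>
    if Q a then X a w * \prod_(i <- r | Q i) X i w else \prod_(i <- r | Q i) X i w).
  by case: (Q a) => //; exact: tameM.
by apply/funext => w; rewrite big_cons.
Qed.

Lemma tame_cintegrable X : tame X -> cintegrable X.
Proof.
move=> [rX mX].
have dom (f : Omega -> R) : measurable_fun setT f ->
    (forall w, `|f w| <= modulus X w) -> P.-integrable setT (fun w => (f w)%:E).
  move=> mf le_f.
  apply: (@le_integrable _ _ _ P setT measurableT _ (EFin \o modulus X)) => //.
  - exact/measurable_EFinP.
  - by move=> w _ /=; rewrite lee_fin (le_trans (le_f w)) // ler_norm.
  apply/integrableP; split; first by apply/measurable_EFinP; exact: measurable_modulus.
  have := mX 1%N; rewrite unlock; congr (_ < _)%E; apply: eq_integral => w _ /=.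
  by rewrite expr1 ger0_norm // modulus_ge0.
by split; apply: dom; [exact: rX.1 | | exact: rX.2 |] => w;
  rewrite modulusE -sqrtr_sqr ler_wsqrtr // ?lerDl ?lerDr sqr_ge0.
Qed.

Lemma cintegrable0 : cintegrable (fun=> 0).
Proof. by split; exact: integrable0. Qed.

Lemma cintegrableD X Y : cintegrable X -> cintegrable Y ->
  cintegrable (fun w => X w + Y w).
Proof.
move=> [X1 X2] [Y1 Y2].
by split; under eq_fun do rewrite raddfD EFinD; exact: integrableD.
Qed.

Lemma cintegrableZ (c : R[i]) X : cintegrable X -> cintegrable (fun w => c * X w).
Proof.
move=> [X1 X2]; split.
  under eq_fun do rewrite ReM EFinB !EFinM.
  by apply: integrableB => //; exact: integrableZl.
under eq_fun do rewrite ImM EFinD !EFinM.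
by apply: integrableD => //; exact: integrableZl.
Qed.

Lemma cintegrable_sum (I : Type) (r : seq I) (Q : pred I) (X : I -> Omega -> R[i]) :
  (forall i, cintegrable (X i)) -> cintegrable (fun w => \sum_(i <- r | Q i) X i w).
Proof.
move=> rX; elim: r => [|a r IH].
  rewrite [X in cintegrable X](_ : _ = fun=> 0); first exact: cintegrable0.
  by apply/funext => w; rewrite big_nil.
rewrite [X in cintegrable X](_ : _ = fun w =>
    if Q a then X a w + \sum_(i <- r | Q i) X i w else \sum_(i <- r | Q i) X i w).
  by case: (Q a) => //; exact: cintegrableD.
by apply/funext => w; rewrite big_cons.
Qed.

Let fineE (f : Omega -> R) : fine 'E_P[f] = (\int[P]_w f w)%R.
Proof. by rewrite unlock. Qed.

Let intZ (c : R) (f : Omega -> R) : P.-integrable setT (EFin \o f) ->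
  P.-integrable setT (EFin \o (fun w => c * f w)).
Proof. by move=> intf; apply: eq_integrable (integrableZl measurableT c intf). Qed.

Lemma eq_cexpect X Y : X =1 Y -> cexpect P X = cexpect P Y.
Proof. by move=> /funext ->. Qed.

Lemma cexpectD X Y : cintegrable X -> cintegrable Y ->
  cexpect P (fun w => X w + Y w) = cexpect P X + cexpect P Y.
Proof.
move=> [X1 X2] [Y1 Y2]; rewrite /cexpect !fineE.
under eq_Rintegral do rewrite raddfD.
rewrite RintegralD //.
by under [in X in _ +i* X]eq_Rintegral do rewrite raddfD; rewrite RintegralD.
Qed.

Lemma cexpectZ (c : R[i]) X : cintegrable X ->
  cexpect P (fun w => c * X w) = c * cexpect P X.
Proof.
move=> [X1 X2]; rewrite /cexpect !fineE.
under eq_Rintegral do rewrite ReM.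
rewrite RintegralB //; [|exact: intZ|exact: intZ].
rewrite !RintegralZl //.
under [in X in _ +i* X]eq_Rintegral do rewrite ImM.
rewrite RintegralD //; [|exact: intZ|exact: intZ].
by rewrite !RintegralZl //; case: c.
Qed.

Lemma cexpect0 : cexpect P (fun=> 0) = 0.
Proof. by rewrite /cexpect !expectation_cst. Qed.

Lemma cexpect1 : cexpect P (fun=> 1) = 1.
Proof. by rewrite /cexpect !expectation_cst. Qed.

Lemma cexpect_sum (I : Type) (r : seq I) (Q : pred I) (X : I -> Omega -> R[i]) :
  (forall i, cintegrable (X i)) ->
  cexpect P (fun w => \sum_(i <- r | Q i) X i w) = \sum_(i <- r | Q i) cexpect P (X i).
Proof.
move=> rX; elim: r => [|a r IH].
  by rewrite big_nil -[RHS]cexpect0; apply: eq_cexpect => w; rewrite big_nil.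
rewrite big_cons (@eq_cexpect _ (fun w =>
    if Q a then X a w + \sum_(i <- r | Q i) X i w else \sum_(i <- r | Q i) X i w)).
  case: (Q a) => //.
  by rewrite cexpectD ?IH //; exact: cintegrable_sum.
by move=> w; rewrite big_cons.
Qed.

End Moments.

Section TameSums.
Context (R : realType) (d : measure_display) (Omega : measurableType d)
  (P : probability Omega R).
Implicit Types X Y : Omega -> R[i].

Lemma crandomD X Y : crandom X -> crandom Y -> crandom (fun w => X w + Y w).
Proof.
move=> [X1 X2] [Y1 Y2].
by split; under eq_fun do rewrite raddfD; exact: measurable_funD.
Qed.

Lemma modulusD X Y w : modulus (fun w => X w + Y w) w <= modulus X w + modulus Y w.
Proof.
by have := ler_normD (X w) (Y w); rewrite /modulus lecE raddfD => /andP[_].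
Qed.

(** From [(a + b) ^ p <= 2 ^ p * (a ^ p + b ^ p)]. *)
Lemma tameD X Y : tame P X -> tame P Y -> tame P (fun w => X w + Y w).
Proof.
move=> [rX mX] [rY mY]; split; first exact: crandomD.
move=> p.
have mf Z q : crandom Z -> measurable_fun setT (fun w => (modulus Z w ^+ q)%:E).
  by move=> rZ; apply/measurable_EFinP; apply: measurable_funX; exact: measurable_modulus.
have m0 Z q w : (0 <= (modulus Z w ^+ q)%:E)%E by rewrite lee_fin exprn_ge0 // modulus_ge0.
have msum : measurable_fun setT (fun w => (modulus X w ^+ p)%:E + (modulus Y w ^+ p)%:E)%E.
  by apply: emeasurable_funD; exact: mf.
apply: (@le_lt_trans _ _ (\int[P]_w ((2 ^+ p)%:E *
    ((modulus X w ^+ p)%:E + (modulus Y w ^+ p)%:E)))%E).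
  rewrite unlock; apply: ge0_le_integral => //.
  - by move=> w _; apply: m0 (fun w => X w + Y w) p w.
  - exact: mf (crandomD rX rY).
  - exact: measurable_funeM.
  - move=> w _.
    rewrite -/(modulus (fun w => X w + Y w) w) -EFinD -EFinM lee_fin.
    have := modulusD X Y w.
    have := modulus_ge0 (fun w => X w + Y w) w.
    have := modulus_ge0 X w; have := modulus_ge0 Y w.
    move: (modulus (fun w => X w + Y w) w) (modulus X w) (modulus Y w) => c a b b0 a0 c0 cab.
    have ap : 0 <= a ^+ p by rewrite exprn_ge0.
    have bp : 0 <= b ^+ p by rewrite exprn_ge0.
    case: (leP a b) => ab.
      apply: (@le_trans _ _ ((2 * b) ^+ p)).
        by apply: lerXn2r; rewrite ?nnegrE ?mulr_ge0 //; lra.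
      by rewrite exprMn ler_wpM2l ?exprn_ge0 // lerDr.
    apply: (@le_trans _ _ ((2 * a) ^+ p)).
      by apply: lerXn2r; rewrite ?nnegrE ?mulr_ge0 //; lra.
    by rewrite exprMn ler_wpM2l ?exprn_ge0 // lerDl.
rewrite ge0_integralZl_EFin ?exprn_ge0 //; last first.
  by move=> w _; rewrite adde_ge0.
rewrite ge0_integralD //; try (by move=> w _; exact: m0); try exact: mf.
rewrite lte_mul_pinfty ?lee_fin ?exprn_ge0 //.
by apply: lte_add_pinfty; [have := mX p | have := mY p]; rewrite unlock.
Qed.

Lemma tame_sum (I : Type) (r : seq I) (Q : pred I) (X : I -> Omega -> R[i]) :
  (forall i, tame P (X i)) -> tame P (fun w => \sum_(i <- r | Q i) X i w).
Proof.
move=> rX; elim: r => [|a r IH].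
  rewrite [X in tame P X](_ : _ = fun=> 0); first exact: tame_cst.
  by apply/funext => w; rewrite big_nil.
rewrite [X in tame P X](_ : _ = fun w =>
    if Q a then X a w + \sum_(i <- r | Q i) X i w else \sum_(i <- r | Q i) X i w).
  by case: (Q a) => //; exact: tameD.
by apply/funext => w; rewrite big_cons.
Qed.

End TameSums.

(** * Expectation of products of independent complex variables *)

Import HBNNSimple.

Section Independence.
Context (R : realType) (d : measure_display) (Omega : measurableType d)
  (P : probability Omega R).

Lemma integral_simple (I : finType) (a : I -> R) (C : I -> set Omega) :
  (forall i, 0 <= a i) -> (forall i, measurable (C i)) ->
  (\int[P]_w (\sum_i a i * \1_(C i) w)%:E)%E = (\sum_i a i * fine (P (C i)))%:E.
Proof.
move=> a0 mC.
under eq_integral do rewrite -sumEFin.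
have mI i : measurable_fun setT (fun w => (\1_(C i) w : R)%:E).
  by apply/measurable_EFinP; exact: measurable_indic.
rewrite ge0_integral_sum //.
- rewrite -sumEFin; apply: eq_bigr => i _.
  under eq_integral do rewrite EFinM.
  rewrite ge0_integralZl_EFin //.
  by rewrite integral_indic // setIT EFinM fineK // fin_num_measure.
- by move=> i; apply/measurable_EFinP; apply: measurable_funM.
- by move=> i w _; rewrite lee_fin mulr_ge0.
Qed.

Variables (L : nat) (dT : 'I_L -> measure_display)
  (T : forall l, measurableType (dT l)) (A : forall l, Omega -> T l).
Hypothesis mA : forall l, measurable_fun setT (A l).
Hypothesis indA : forall B : forall l, set (T l), (forall l, measurable (B l)) ->
  P (\bigcap_(l in [set: 'I_L]) (A l @^-1` B l)) = (\prod_(l < L) P (A l @^-1` B l))%E.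

Let fine_prod (f : 'I_L -> \bar R) : (forall l, f l \is a fin_num) ->
  fine (\prod_(l < L) f l)%E = \prod_(l < L) fine (f l).
Proof.
move=> ff; suff -> : (\prod_(l < L) f l)%E = (\prod_(l < L) fine (f l))%:E by [].
rewrite -prodEFin; apply: eq_bigr => l _; by rewrite fineK.
Qed.

(** Once the product is expanded, each term involves one event per factor, and
    independence applies to these events.  The coefficients are common to all
    the factors so that a term is indexed by a function from factors to levels. *)
Lemma indep_simple (M : nat) (c : 'I_M -> R) (B : forall l, 'I_M -> set (T l)) :
  (forall k, 0 <= c k) -> (forall l k, measurable (B l k)) ->
  (\int[P]_w (\prod_l \sum_k c k * \1_(B l k) (A l w))%:E)%E =
  (\prod_l \int[P]_w (\sum_k c k * \1_(B l k) (A l w))%R)%:E.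
Proof.
move=> c0 mB.
have mAB l k : measurable (A l @^-1` B l k) by rewrite -[X in measurable X]setTI; exact: mA.
have sE l : \int[P]_w (\sum_k c k * \1_(B l k) (A l w))%R =
    \sum_k c k * fine (P (A l @^-1` B l k)).
  by rewrite /Rintegral (@integral_simple _ c (fun k => A l @^-1` B l k)).
under [in RHS]eq_bigr do rewrite sE.
rewrite bigA_distr_bigA /=.
pose D (k : {ffun 'I_L -> 'I_M}) := \bigcap_(l in [set: 'I_L]) (A l @^-1` B l (k l)).
under eq_integral => w _.
  rewrite bigA_distr_bigA /=.
  under eq_bigr => k _.
    rewrite big_split /= (_ : \prod_(i < L) \1_(B i (k i)) (A i w) = \1_(D k) w); last first.
      rewrite indicE; case: (boolP (w \in D k)) => [/set_mem wD|wD].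
        by apply: big1 => l _; rewrite indicE mem_set //; exact: wD.
      have [l lw] : exists l, ~ B l (k l) (A l w).
        apply/existsNP => wB; move/negP: wD; apply; apply/mem_set => l _; exact: wB.
      by rewrite (bigD1 l) //= indicE memNset // mul0r.
    over.
  over.
rewrite (@integral_simple _ (fun k : {ffun 'I_L -> 'I_M} => \prod_i c (k i)) D).
- congr EFin; apply: eq_bigr => k _; rewrite big_split /=; congr (_ * _).
  by rewrite indA // fine_prod // => l; apply: fin_num_measure.
- by move=> k; apply: prodr_ge0.
- by move=> k; apply: fin_bigcap_measurable => // l _.
Qed.

(** Dyadic approximations increase to the integrands, and those of a given order
    have the same coefficients for all the factors; monotone convergence carries
    the identity over from [indep_simple]. *)
Lemma indep_ge0 (Y : forall l, T l -> R) :
  (forall l, measurable_fun setT (Y l)) -> (forall l x, 0 <= Y l x) ->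
  (forall l, P.-integrable setT (fun w => (Y l (A l w))%:E)) ->
  (\int[P]_w (\prod_l Y l (A l w))%:E)%E = (\prod_l \int[P]_w (Y l (A l w)))%:E.
Proof.
move=> mY Y0 iY.
have mEY l : measurable_fun setT (EFin \o Y l) by apply/measurable_EFinP.
have E0 l x : setT x -> (0 <= (EFin \o Y l) x)%E by move=> _; rewrite lee_fin.
pose f l n : T l -> R := nnsfun_approx measurableT (mEY l) n.
have fE l n x : f l n x = approx setT (EFin \o Y l) n x by rewrite /f nnsfun_approxE.
have f_ge0 l n x : 0 <= f l n x by [].
have mf l n : measurable_fun setT (f l n) by exact: measurable_funPT.
have f_nd l x : {homo (fun n => f l n x) : n m / (n <= m)%N >-> n <= m}.
  by move=> n m nm; have /lefP := nd_nnsfun_approx measurableT (mEY l) nm; exact.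
have f_cvg l x : f l n x @[n --> \oo] --> Y l x.
  exact: (fine_cvg (cvg_nnsfun_approx measurableT (mEY l) (E0 l) (x:=x) I)).
have simpleE n : (\int[P]_w (\prod_l f l n (A l w))%:E)%E =
    (\prod_l \int[P]_w (f l n (A l w)))%:E.
  pose M := (n * 2 ^ n)%N.
  pose c (k : 'I_M.+1) : R := if (k < M)%N then k%:R / 2 ^+ n else n%:R.
  pose B l (k : 'I_M.+1) : set (T l) := if (k < M)%N then
    dyadic_approx setT (EFin \o Y l) n k else integer_approx setT (EFin \o Y l) n.
  have fS l w : f l n (A l w) = \sum_k c k * \1_(B l k) (A l w).
    rewrite fE /approx big_ord_recr /= /c /B ltnn; congr (_ + _).
    apply: eq_bigr => k _; have kM : (k < M)%N := ltn_ord k.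
    by rewrite /= kM.
  under eq_integral do under eq_bigr do rewrite fS.
  under [in RHS]eq_bigr do under eq_Rintegral do rewrite fS.
  apply: indep_simple.
  - by move=> k; rewrite /c; case: ifP => _ //; rewrite divr_ge0 // exprn_ge0.
  - move=> l k; rewrite /B; case: ifP => _.
      exact: (measurable_fun_approximation.mA_subproof measurableT (mEY l)).
    exact: (measurable_fun_approximation.mB_subproof measurableT (mEY l)).
have mfA l n : measurable_fun setT (fun w => f l n (A l w)).
  exact: (@measurableT_comp _ _ _ _ _ _ (f l n) setT (A l) (mf l n) (@mA l)).
have lim1 : (\int[P]_w (\prod_l f l n (A l w))%:E)%E @[n --> \oo] -->
    (\int[P]_w (\prod_l Y l (A l w))%:E)%E.
  (* the limit is taken inside the integral, pointwise in [w] *)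
  have -> : (\int[P]_w (\prod_l Y l (A l w))%:E)%E =
      (\int[P]_w (limn (fun n => (\prod_l f l n (A l w))%:E)))%E.
    apply: eq_integral => w _; apply/esym/cvg_lim => //.
    apply: cvg_EFin; first by near=> n.
    by apply: cvg_big => [|l _]; [exact: mul_continuous | exact: f_cvg].
  apply: (@cvg_monotone_convergence _ _ _ P setT measurableT
     (fun n w => (\prod_l f l n (A l w))%:E)).
  - move=> n; apply/measurable_EFinP.
    by apply: measurable_prod => l _; exact: mfA.
  - by move=> n w _; rewrite lee_fin prodr_ge0.
  - move=> w _ n m nm; rewrite lee_fin; apply: ler_prod => l _.
    by rewrite f_ge0 f_nd.
have lim2 l : \int[P]_w (f l n (A l w)) @[n --> \oo] --> \int[P]_w (Y l (A l w)).
  have -> : \int[P]_w (Y l (A l w)) =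
      fine (\int[P]_w (limn (fun n => (f l n (A l w))%:E)))%E.
    congr fine; apply: eq_integral => w _; apply/esym/cvg_lim => //.
    by apply: cvg_EFin; [near=> n | exact: f_cvg].
  apply: fine_cvg; rewrite fineK.
    apply: (@cvg_monotone_convergence _ _ _ P setT measurableT
     (fun n w => (f l n (A l w))%:E)).
    - by move=> n; apply/measurable_EFinP; exact: mfA.
    - by move=> n w _; rewrite lee_fin.
    - by move=> w _ n m nm; rewrite lee_fin f_nd.
  rewrite (_ : (\int[P]_w _)%E = (\int[P]_w (Y l (A l w))%:E)%E).
    exact: integrable_fin_num.
  apply: eq_integral => w _; apply/cvg_lim => //.
  by apply: cvg_EFin; [near=> n | exact: f_cvg].
apply: cvg_unique lim1 _ => //.
rewrite (funext simpleE).
apply: cvg_EFin; first by near=> n.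
by apply: cvg_big => [|l _]; [exact: mul_continuous | exact: lim2].
Unshelve. all: end_near.
Qed.

End Independence.

Section ComplexIndependence.
Context (R : realType).

(** A complex number is the combination with coefficients [1, -1, i, -i] of the
    positive and negative parts of its real and imaginary parts.  Identities
    proved for nonnegative variables extend to complex ones by multilinearity. *)
Definition part4 (k : 'I_4) (x : R[i]) : R :=
  Num.max (nth 0 [:: complex.Re x; - complex.Re x; complex.Im x; - complex.Im x] k) 0.

Definition unit4 (k : 'I_4) : R[i] := nth 0 [:: 1; -1; 'i; - 'i] k.

Lemma part4_ge0 k x : 0 <= part4 k x.
Proof. by rewrite /part4 le_max lexx orbT. Qed.

Lemma part4E x : x = \sum_k unit4 k * (part4 k x)%:C.
Proof.
have maxB (a : R) : Num.max a 0 - Num.max (- a) 0 = a.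
  by case: (lerP 0 a) => a0; [rewrite (max_idPr _) ?oppr_le0 // subr0
    | rewrite (max_idPl _) ?oppr_ge0 1?ltW // opprK add0r].
rewrite !big_ord_recl big_ord0 /unit4 /part4 /=; case: x => a b /=.
by apply/eqP; rewrite eq_complex /=; apply/andP; split; apply/eqP;
   rewrite -[LHS]maxB; ring.
Qed.

Lemma measurable_part4 d (T : measurableType d) (X : T -> R[i]) k :
  crandom X -> measurable_fun setT (fun w => part4 k (X w)).
Proof.
move=> [mR mI]; apply: measurable_maxr => //.
by case: k => [[|[|[|[|k]]]] Hk] //=; exact: measurableT_comp.
Qed.

Context (d : measure_display) (Omega : measurableType d) (P : probability Omega R).

Lemma integrable_part4 (X : Omega -> R[i]) k : cintegrable P X ->
  P.-integrable setT (fun w => (part4 k (X w))%:E).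
Proof.
move=> [iR iI].
have mX : crandom X by split; apply/measurable_EFinP; [case/integrableP: iR|case/integrableP: iI].
have dom (f g : Omega -> R) : measurable_fun setT f -> P.-integrable setT (EFin \o g) ->
    (forall w, `|f w| <= `|g w|) -> P.-integrable setT (fun w => (f w)%:E).
  move=> mf ig fg; apply: (@le_integrable _ _ _ P setT measurableT _ (EFin \o g)) => //.
    exact/measurable_EFinP.
  by move=> w _ /=; rewrite lee_fin.
have le_max0 (a : R) : `|Num.max a 0| <= `|a|.
  by case: (lerP 0 a) => a0; rewrite ?normr0.
have {}iR : P.-integrable setT (EFin \o (fun w => complex.Re (X w))) := iR.
have {}iI : P.-integrable setT (EFin \o (fun w => complex.Im (X w))) := iI.
have := measurable_part4 k mX.
by case: k => [[|[|[|[|k]]]] Hk] // mk; [apply: dom mk iR _|apply: dom mk iR _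
  |apply: dom mk iI _|apply: dom mk iI _] => w; rewrite /part4 /=;
  apply: le_trans (le_max0 _) _; rewrite ?normrN.
Qed.

Lemma cexpect_real (Y : Omega -> R) :
  cexpect P (fun w => (Y w)%:C) = (\int[P]_w Y w)%:C.
Proof.
by rewrite /cexpect expectation_cst unlock.
Qed.

Lemma cintegrable_real (Y : Omega -> R) : P.-integrable setT (EFin \o Y) ->
  cintegrable P (fun w => (Y w)%:C).
Proof. by move=> iY; split => //; exact: integrable0. Qed.

Lemma cexpect_part4 (X : Omega -> R[i]) : cintegrable P X ->
  cexpect P X = \sum_k unit4 k * (\int[P]_w part4 k (X w))%:C.
Proof.
move=> iX; rewrite (eq_cexpect _ (fun w => part4E (X w))) cexpect_sum.
  apply: eq_bigr => k _; rewrite cexpectZ ?cexpect_real //.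
  exact/cintegrable_real/integrable_part4.
by move=> k; apply/cintegrableZ/cintegrable_real/integrable_part4.
Qed.

Lemma cexpect_indep (L : nat) (dT : 'I_L -> measure_display)
    (T : forall l, measurableType (dT l)) (A : forall l, Omega -> T l)
    (X : forall l, T l -> R[i]) :
  (forall l, measurable_fun setT (A l)) ->
  (forall B : forall l, set (T l), (forall l, measurable (B l)) ->
    P (\bigcap_(l in [set: 'I_L]) (A l @^-1` B l)) = (\prod_(l < L) P (A l @^-1` B l))%E) ->
  (forall l, crandom (X l)) ->
  (forall l, cintegrable P (fun w => X l (A l w))) ->
  cexpect P (fun w => \prod_l X l (A l w)) = \prod_l cexpect P (fun w => X l (A l w)).
Proof.
move=> mA indA mX iX.
pose Y (k : {ffun 'I_L -> 'I_4}) w : R := \prod_l part4 (k l) (X l (A l w)).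
have intE k := indep_ge0 mA indA (fun l => measurable_part4 (k l) (mX l))
  (fun l x => part4_ge0 (k l) (X l x)) (fun l => integrable_part4 (k l) (iX l)).
have iY k : P.-integrable setT (EFin \o Y k).
  apply/integrableP; split.
    apply/measurable_EFinP; apply: measurable_prod => l _.
    by apply: (@measurable_part4 _ _ (fun w => X l (A l w))); split;
      apply/measurable_EFinP; [case/integrableP: (iX l).1|case/integrableP: (iX l).2].
  rewrite (eq_integral (fun w => (Y k w)%:E)) ?intE ?ltry // => w _ /=.
  by rewrite ger0_norm //; apply: prodr_ge0 => l _; exact: part4_ge0.
rewrite (@eq_cexpect _ _ _ _ _ (fun w => \sum_(k : {ffun 'I_L -> 'I_4})
     (\prod_l unit4 (k l)) * (Y k w)%:C)); last first.
  move=> w; under eq_bigr do rewrite (part4E (X _ _)).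
  rewrite bigA_distr_bigA /=; apply: eq_bigr => k _.
  by rewrite big_split /= /Y rmorph_prod.
rewrite cexpect_sum; last by move=> k; exact/cintegrableZ/cintegrable_real.
under [RHS]eq_bigr do rewrite cexpect_part4 //.
rewrite bigA_distr_bigA /=; apply: eq_bigr => k _.
rewrite cexpectZ; last exact/cintegrable_real.
by rewrite cexpect_real big_split /= -rmorph_prod /= /Rintegral /Y intE.
Qed.

End ComplexIndependence.

(** * The measurable space of families of matrices *)

(** An alias on which a base point is declared, so that the cylinders generate a
    measurable space on it. *)
Definition matrix_family (R : realType) (K : Type) (N : nat) : Type := K -> 'M[R[i]]_N.

HB.instance Definition _ (R : realType) (K : Type) (N : nat) :=
  gen_eqMixin (matrix_family R K N).
HB.instance Definition _ (R : realType) (K : Type) (N : nat) :=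
  gen_choiceMixin (matrix_family R K N).
HB.instance Definition _ (R : realType) (K : Type) (N : nat) :=
  isPointed.Build (matrix_family R K N) (fun=> 0).

Notation family_space R K N :=
  (g_sigma_algebraType (@family_cylinder R K N : set (set (matrix_family R K N)))).

Section FamilySpace.
Context (R : realType) (K : Type) (N : nat).

Lemma crandom_entry (k : K) (i j : 'I_N) :
  crandom (fun F : family_space R K N => (F : K -> 'M[R[i]]_N) k i j).
Proof.
by split=> _ B mB; rewrite setTI; apply: sub_gen_smallest;
  exists k, i, j, B; split=> //; [left|right].
Qed.

Context (d : measure_display) (Omega : measurableType d) (P : probability Omega R).

Lemma measurable_family (A : Omega -> K -> 'M[R[i]]_N) :
  (forall k i j, crandom (fun w => A w k i j)) ->
  measurable_fun setT (A : Omega -> family_space R K N).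
Proof.
move=> rA; refine (@measurability d _ Omega (family_space R K N) setT A
  (@family_cylinder R K N) _ _) => //.
move=> _ [C [k [i [j [B [mB CE]]]]] <-].
have [mR mI] := rA k i j.
by case: CE => ->; [exact: mR | exact: mI].
Qed.

Lemma cexpect_same_law (A A' : Omega -> K -> 'M[R[i]]_N) (f : (K -> 'M[R[i]]_N) -> R[i]) :
  (forall k i j, crandom (fun w => A w k i j)) ->
  (forall k i j, crandom (fun w => A' w k i j)) ->
  same_law P A A' -> crandom (f : family_space R K N -> R[i]) ->
  cintegrable P (fun w => f (A w)) -> cintegrable P (fun w => f (A' w)) ->
  cexpect P (fun w => f (A w)) = cexpect P (fun w => f (A' w)).
Proof.
move=> rA rA' AA' rf iA iA'.
have mA := measurable_family rA; have mA' := measurable_family rA'.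
rewrite !cexpect_part4 //; apply: eq_bigr => k _; congr (_ * _%:C); congr fine.
have mp : measurable_fun setT (fun F : family_space R K N => (part4 k (f F))%:E).
  by apply/measurable_EFinP; exact: measurable_part4.
have p0 F : F \in [set: family_space R K N] -> (0 <= (part4 k (f F))%:E)%E.
  by move=> _; rewrite lee_fin part4_ge0.
have := ge0_integral_pushforward mA P measurableT mp p0.
have := ge0_integral_pushforward mA' P measurableT mp p0.
rewrite !preimage_setT /comp => <- <-.
by apply: eq_measure_integral => B mB _; rewrite /pushforward; exact: AA'.
Qed.

End FamilySpace.

(** * Limits of complex sequences *)

Section ComplexLimits.
Context (R : realType).
Implicit Types (u v : nat -> R[i]) (a b : R[i]).

Lemma ccvg_cst a : ccvg (fun=> a) a.
Proof. exact: cvg_cst. Qed.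

Lemma ccvgD u v a b : ccvg u a -> ccvg v b -> ccvg (fun N => u N + v N) (a + b).
Proof. by move=> ua vb; exact: cvgD ua vb. Qed.

Lemma ccvgM u v a b : ccvg u a -> ccvg v b -> ccvg (fun N => u N * v N) (a * b).
Proof. by move=> ua vb; exact: (@cvgM R[i] _ _ _ u v a b ua vb). Qed.

Lemma ccvg_eq u v a : ccvg v a -> (forall N, u N = v N) -> ccvg u a.
Proof. by move=> va /funext ->. Qed.

Lemma ccvg_near u v a : ccvg v a ->
  (exists N0, forall N, (N0 <= N)%N -> u N = v N) -> ccvg u a.
Proof.
move=> va [N0 uv]; apply: cvg_trans va; apply: near_eq_cvg.
by exists N0 => // N /= /uv ->.
Qed.

Lemma ccvg_sum (I : Type) (r : seq I) (Q : pred I) (u : I -> nat -> R[i]) (a : I -> R[i]) :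
  (forall i, Q i -> ccvg (u i) (a i)) ->
  ccvg (fun N => \sum_(i <- r | Q i) u i N) (\sum_(i <- r | Q i) a i).
Proof.
move=> ua; elim: r => [|i r IH].
  by rewrite big_nil; refine (ccvg_eq (@ccvg_cst 0) _) => N; rewrite big_nil.
rewrite big_cons; case: (boolP (Q i)) => Qi.
  by refine (ccvg_eq (ccvgD (ua i Qi) IH) _) => N; rewrite big_cons Qi.
by refine (ccvg_eq IH _) => N; rewrite big_cons (negPf Qi).
Qed.

Lemma ccvg_prod (I : Type) (r : seq I) (u : I -> nat -> R[i]) (a : I -> R[i]) :
  (forall i, ccvg (u i) (a i)) ->
  ccvg (fun N => \prod_(i <- r) u i N) (\prod_(i <- r) a i).
Proof.
move=> ua; elim: r => [|i r IH].
  by rewrite big_nil; refine (ccvg_eq (@ccvg_cst 1) _) => N; rewrite big_nil.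
by rewrite big_cons; refine (ccvg_eq (ccvgM (ua i) IH) _) => N; rewrite big_cons.
Qed.

Lemma ccvgX u a n : ccvg u a -> ccvg (fun N => u N ^+ n) (a ^+ n).
Proof.
move=> ua; elim: n => [|n IH]; first by refine (ccvg_eq (@ccvg_cst 1) _) => N; rewrite expr0.
by rewrite exprS; refine (ccvg_eq (ccvgM ua IH) _) => N; rewrite exprS.
Qed.

Lemma ccvgV u a : a != 0 -> ccvg u a -> ccvg (fun N => (u N)^-1) a^-1.
Proof. by move=> a0 ua; exact: (@cvgV R[i] _ _ _ u a a0 ua). Qed.

Lemma ccvg_unique u a b : ccvg u a -> ccvg u b -> a = b.
Proof. exact: (@cvg_unique R[i]^o (@norm_hausdorff R[i] R[i]^o)). Qed.

Lemma ccvg_inv : ccvg (fun N => N%:R^-1 : R[i]) 0.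
Proof.
apply/(@cvgr0Pnorm_lt R[i] R[i]^o) => e e0.
have [r r0 er] : exists2 r : R, 0 < r & e = r%:C.
  move: e e0 => [r im]; rewrite ltcE /= => /andP[/eqP -> r0]; by exists r.
have := @near_infty_natSinv_lt R (PosNum r0) => -[N0 _ h].
exists N0.+1 => // -[//|N] /= NN.
rewrite normfV normr_nat er -(rmorph_nat (real_complex R)) -fmorphV ltcR.
exact: h.
Qed.

Lemma ccvg_ffact n : ccvg (fun N => (N ^_ n)%:R * N%:R^-1 ^+ n : R[i]) 1.
Proof.
have e1 : \prod_(i < n) (1 - i%:R * 0) = 1 :> R[i].
  by rewrite big1 // => i _; rewrite mulr0 subr0.
rewrite -[X in ccvg _ X]e1.
refine (@ccvg_near _ (fun N => \prod_(i < n) (1 - i%:R * N%:R^-1)) _ _ _); last first.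
  exists n.+1 => N nN; rewrite ffact_prod natr_prod (_ : N%:R^-1 ^+ n = \prod_(i < n) N%:R^-1).
    2: by rewrite prodr_const card_ord.
  rewrite -big_split /=; apply: eq_bigr => i _.
  have N0 : N%:R != 0 :> R[i] by rewrite pnatr_eq0 -lt0n (leq_trans _ nN).
  by rewrite natrB ?mulrBl ?divff // (leq_trans (ltnW (ltn_ord i))) // ltnW.
apply: ccvg_prod => i; apply: ccvgD; first exact: ccvg_cst.
rewrite -mulNr.
refine (ccvg_eq (ccvgM (@ccvg_cst (- i%:R)) ccvg_inv) _) => N.
by rewrite mulNr.
Qed.

End ComplexLimits.

(** * Connected graphs *)

Section ConnectLemmas.

Lemma connect_homo (V W : finType) (e : rel V) (e' : rel W) (f : V -> W) :
  (forall u v, e u v -> connect e' (f u) (f v)) ->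
  forall u v, connect e u v -> connect e' (f u) (f v).
Proof.
move=> fe u v /connectP[p + ->]; elim: p u => [|x p IH] u /=; first by rewrite connect0.
by case/andP=> /fe ux /IH; exact: connect_trans.
Qed.

Variable K : Type.

Lemma adjacentP (T : lgraph K) (u v : vert T) :
  reflect (exists e : edge T, (src e = u /\ tgt e = v) \/ (src e = v /\ tgt e = u))
          (adjacent u v).
Proof.
apply: (iffP existsP) => -[e He]; exists e.
  by case/orP: He => /andP[/eqP ? /eqP ?]; [left|right].
by case: He => -[-> ->]; rewrite !eqxx ?orbT.
Qed.

Lemma adjacent_sym (T : lgraph K) : symmetric (@adjacent K T).
Proof. by move=> u v; apply/adjacentP/adjacentP => -[e He]; exists e; tauto. Qed.

Lemma adjacent_edge (T : lgraph K) (e : edge T) : adjacent (src e) (tgt e).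
Proof. by apply/adjacentP; exists e; left. Qed.

Lemma adjacent_connect (T : lgraph K) (W : finType) (e' : rel W) (f : vert T -> W) :
  connect_sym e' ->
  (forall e : edge T, connect e' (f (src e)) (f (tgt e))) ->
  forall u v, connect (@adjacent K T) u v -> connect e' (f u) (f v).
Proof.
move=> se fe; apply: connect_homo => u v /adjacentP[e [[<- <-]|[<- <-]]] //.
by rewrite se.
Qed.

Lemma adjacent_connect_sym (T : lgraph K) : connect_sym (@adjacent K T).
Proof. exact/sym_connect_sym/adjacent_sym. Qed.

Lemma connectedP (T : lgraph K) :
  reflect ((exists v : vert T, True) /\ forall u v : vert T, connect (@adjacent K T) u v)
          (connected T).
Proof.
apply: (iffP andP) => -[h1 h2]; split.
- by case/card_gt0P: h1 => v _; exists v.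
- by move=> u v; move/forallP: h2 => /(_ u)/forallP; exact.
- by apply/card_gt0P; case: h1 => v _; exists v.
- by apply/forallP => u; apply/forallP => v; exact: h2.
Qed.

End ConnectLemmas.

(** * Kernels of maps, quotient graphs and Moebius inversion *)

Section Kernel.

(** A canonical name for the kernel of [f]: two functions have the same kernel if
    and only if they have the same [kernel_rep].  The maps [r] fixed by
    [kernel_rep] thus index the partitions of [V], each block being named by one
    of its points. *)
Definition kernel_rep (V : finType) (S : eqType) (f : V -> S) : {ffun V -> V} :=
  [ffun v => odflt v [pick u | f u == f v]].

Lemma kernel_repK (V : finType) (S : eqType) (f : V -> S) v : f (kernel_rep f v) = f v.
Proof. by rewrite ffunE; case: pickP => [u /eqP //|/(_ v)]; rewrite eqxx. Qed.

Lemma kernel_rep_eq (V : finType) (S : eqType) (f : V -> S) u v :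
  (kernel_rep f u == kernel_rep f v) = (f u == f v).
Proof.
apply/eqP/eqP => [E|E]; first by rewrite -(kernel_repK f u) E kernel_repK.
rewrite !ffunE (@eq_pick _ (fun x => f x == f u) (fun x => f x == f v)); last first.
  by move=> x /=; rewrite E.
by case: pickP => [x //|/(_ v)]; rewrite eqxx.
Qed.

Lemma eq_kernel_rep (V : finType) (S S' : eqType) (f : V -> S) (g : V -> S') :
  (forall u v, (f u == f v) = (g u == g v)) -> kernel_rep f = kernel_rep g.
Proof.
move=> fg; apply/ffunP => v; rewrite !ffunE; congr odflt; apply: eq_pick => x /=.
exact: fg.
Qed.

Lemma kernel_rep_idem (V : finType) (S : eqType) (f : V -> S) :
  kernel_rep (kernel_rep f) = kernel_rep f.
Proof. by apply: eq_kernel_rep => u v; exact: kernel_rep_eq. Qed.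

Lemma kernel_rep_id (V : finType) (S : eqType) (f : V -> S) :
  (kernel_rep f == [ffun v => v]) = injectiveb f.
Proof.
apply/eqP/injectiveP => [E u v /eqP fuv|fI].
  by move: fuv; rewrite -kernel_rep_eq E !ffunE => /eqP.
by apply/ffunP => v; apply: fI; rewrite kernel_repK ffunE.
Qed.

Lemma kernel_rep_fix (V : finType) (r : {ffun V -> V}) x : kernel_rep r = r ->
  x \in codom r -> r x = x.
Proof. by move=> rE /codomP[v ->]; have := kernel_repK r v; rewrite rE. Qed.

End Kernel.

Section Quotient.
Variable K : Type.

Definition qproj (V : finType) (r : {ffun V -> V}) (v : V) : {x | x \in codom r} :=
  exist _ (r v) (codom_f r v).

(** The blocks are named by their representatives, the points of the image of
    [r]; edges are kept, with their multiplicities. *)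
Definition quot (T : lgraph K) (r : {ffun vert T -> vert T}) : lgraph K :=
  @LGraph K {x | x \in codom r} (edge T)
    (fun e => qproj r (src e)) (fun e => qproj r (tgt e)) (@lab _ T) (@star _ T).

Lemma quot_connect (T : lgraph K) (r : {ffun vert T -> vert T}) u v :
  connect (@adjacent K T) u v ->
  connect (@adjacent K (quot r)) (qproj r u) (qproj r v).
Proof.
apply: adjacent_connect; first exact: adjacent_connect_sym.
by move=> e; apply: connect1; exact: (@adjacent_edge _ (quot r) e).
Qed.

Lemma qproj_surj (V : finType) (r : {ffun V -> V}) (x : {x | x \in codom r}) :
  exists v, x = qproj r v.
Proof. by case: x => x Hx; have [v E] := codomP Hx; exists v; apply: val_inj. Qed.

Lemma quot_connected (T : lgraph K) (r : {ffun vert T -> vert T}) :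
  connected T -> connected (quot r).
Proof.
move=> /connectedP[[v _] cT]; apply/connectedP; split; first by exists (qproj r v).
move=> x y; have [u ->] := qproj_surj x; have [w ->] := qproj_surj y.
exact: quot_connect.
Qed.

Lemma card_quot (T : lgraph K) (r : {ffun vert T -> vert T}) :
  kernel_rep r == r -> r != [ffun v => v] -> (#|vert (quot r)| < #|vert T|)%N.
Proof.
move=> /eqP rE rI; rewrite /= card_sig -cardsT.
have -> : #|[pred x | x \in codom r]| = #|[set x | x \in codom r]%SET| by rewrite cardsE.
apply: proper_card; rewrite properT; apply: contra rI => /eqP cE.
apply/eqP/ffunP => v; rewrite ffunE; apply: kernel_rep_fix => //.
have : v \in [set: vert T]%SET by rewrite finset.in_setT.
by rewrite -cE finset.inE.
Qed.

Variables (R : realType) (N : nat).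
Implicit Type A : K -> 'M[R[i]]_N.

Definition inj_sum A (T : lgraph K) : R[i] :=
  \sum_(phi : {ffun vert T -> 'I_N} | injectiveb phi) weight A phi.

Lemma inj_traceE A T : inj_trace A T = N%:R^-1 * inj_sum A T.
Proof. by []. Qed.

(** A map amounts to its kernel together with an injective map on the quotient. *)
Lemma kernel_sum A (T : lgraph K) (Q : pred {ffun vert T -> vert T}) :
  \sum_(phi : {ffun vert T -> 'I_N} | Q (kernel_rep phi)) weight A phi =
  \sum_(r : {ffun vert T -> vert T} | (kernel_rep r == r) && Q r) inj_sum A (quot r).
Proof.
rewrite (partition_big (fun phi : {ffun vert T -> 'I_N} => kernel_rep phi)
   (fun r : {ffun vert T -> vert T} => (kernel_rep r == r) && Q r)) /=; last first.
  by move=> phi Qp; rewrite kernel_rep_idem eqxx.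
apply: eq_bigr => r /andP[/eqP rE Qr].
pose h (psi : {ffun vert (quot r) -> 'I_N}) : {ffun vert T -> 'I_N} :=
  [ffun v => psi (qproj r v)].
pose h' (phi : {ffun vert T -> 'I_N}) : {ffun vert (quot r) -> 'I_N} :=
  [ffun x => phi (val x)].
have qv (x : vert (quot r)) : qproj r (val x) = x.
  by apply: val_inj => /=; apply: kernel_rep_fix => //; exact: (valP x).
rewrite (reindex_onto h h') /=; last first.
  move=> phi /andP[_ /eqP pr]; apply/ffunP => v; rewrite !ffunE /= -pr.
  exact: kernel_repK.
apply: eq_big => [psi|psi _].
  have -> : h' (h psi) == psi.
    by apply/eqP/ffunP => x; rewrite !ffunE qv.
  rewrite andbT; apply/andP/injectiveP => [[_ /eqP E] x y xy|psiI].
    suff : kernel_rep (h psi) (val x) == kernel_rep (h psi) (val y).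
      by rewrite E => /eqP rxy; rewrite -(qv x) -(qv y); exact: val_inj.
    by rewrite kernel_rep_eq !ffunE !qv xy.
  suff -> : kernel_rep (h psi) = r by [].
  rewrite -[RHS]rE; apply: eq_kernel_rep => u v; rewrite !ffunE (inj_eq psiI).
  by [].
apply: eq_bigr => e _; by rewrite !ffunE.
Qed.

Lemma inj_sum_quot_id A (T : lgraph K) : inj_sum A (quot [ffun v : vert T => v]) = inj_sum A T.
Proof.
transitivity (\sum_(phi : {ffun vert T -> 'I_N} | kernel_rep phi == [ffun v => v]) weight A phi).
  rewrite (kernel_sum A (fun r => r == [ffun v => v])) (big_pred1 [ffun v => v]) // => r /=.
  apply/andP/eqP => [[_ /eqP] //|->]; split=> //.
  by rewrite kernel_rep_id; apply/injectiveP => u v; rewrite !ffunE.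
by apply: eq_bigl => phi; rewrite kernel_rep_id.
Qed.

Lemma kernel_sum_id A (T : lgraph K) (Q : pred {ffun vert T -> vert T}) :
  Q [ffun v => v] ->
  \sum_(phi : {ffun vert T -> 'I_N} | Q (kernel_rep phi)) weight A phi =
  inj_sum A T +
  \sum_(r : {ffun vert T -> vert T} | [&& kernel_rep r == r, Q r & r != [ffun v => v]])
     inj_sum A (quot r).
Proof.
move=> Q1; rewrite kernel_sum (bigD1 [ffun v => v]) /=; last first.
  by rewrite Q1 andbT kernel_rep_id; apply/injectiveP => u v; rewrite !ffunE.
by rewrite inj_sum_quot_id; congr (_ + _); apply: eq_bigl => r; rewrite andbA.
Qed.

Lemma ntr_gm_eval A (g : gmonomial K) : ntr (gm_eval A g) =
  N%:R^-1 * \sum_(phi : {ffun vert g -> 'I_N} | phi (gm_out g) == phi (gm_in g)) weight A phi.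
Proof.
rewrite /ntr; congr (_ * _); rewrite /mxtrace.
under eq_bigr do rewrite mxE.
rewrite [RHS](partition_big (fun phi : {ffun vert g -> 'I_N} => phi (gm_out g)) xpredT) //=.
apply: eq_bigr => i _; apply: eq_bigl => phi.
by rewrite [RHS]andbC; case: eqP => [->|] //=; rewrite eq_sym.
Qed.

Lemma ntr_gp_eval A (g : gpoly R K) :
  ntr (gp_eval A g) = \sum_(t <- g) t.1 * ntr (gm_eval A t.2).
Proof.
rewrite /ntr /gp_eval raddf_sum /= mulr_sumr; apply: eq_bigr => t _.
by rewrite mxtraceZ mulrCA.
Qed.

End Quotient.

Section Moebius.
Context (R : realType) (K : Type).

Lemma connected_vertex (T : star_test_graph K) : vert T.
Proof.
by have /andP[+ _] := tg_connected T; case: (pickP (vert T)) => [v _ _|/eq_card0 ->//].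
Qed.

Definition quot_test (T : star_test_graph K) (r : {ffun vert T -> vert T}) :
    star_test_graph K := StarTestGraph (quot_connected r (tg_connected T)).

(** Moebius inversion: the injective maps are all the maps minus those that are
    injective on a proper quotient, which has fewer vertices. *)
Lemma inj_trace_gpoly (T : star_test_graph K) : exists g : gpoly R K,
  forall N (A : K -> 'M[R[i]]_N), inj_trace A T = ntr (gp_eval A g).
Proof.
have [n] := ubnP #|vert T|; elim: n T => // n IH T leTn.
pose ok (r : {ffun vert T -> vert T}) := (kernel_rep r == r) && (r != [ffun v => v]).
have /choice[g gP] : forall r : {ffun vert T -> vert T}, exists g : gpoly R K, ok r ->
    forall N (A : K -> 'M[R[i]]_N), inj_trace A (quot r) = ntr (gp_eval A g).
  move=> r; case: (boolP (ok r)) => [/andP[r1 r2]|_]; last by exists [::].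
  have [|g gE] := IH (quot_test r); last by exists g.
  exact: leq_trans (card_quot r1 r2) leTn.
pose v := connected_vertex T.
exists ((1, @GMonomial K T v v) ::
  flatten [seq [seq (- t.1, t.2) | t <- g r] | r <- enum ok]) => N A.
rewrite ntr_gp_eval big_cons mul1r ntr_gm_eval /=.
rewrite (_ : \sum_(_ | _) _ =
    inj_sum A T + \sum_(r : {ffun vert T -> vert T} | ok r) inj_sum A (quot r)); last first.
  etransitivity; last exact: (@kernel_sum_id _ _ _ A T xpredT isT).
  by apply: eq_bigl => phi; rewrite eqxx.
rewrite mulrDr big_flatten big_map big_enum /= -addrA.
rewrite inj_traceE -[LHS]addr0; congr (_ + _).
rewrite mulr_sumr -big_split /= big1 // => r okr.
rewrite big_map /= -inj_traceE gP // ntr_gp_eval.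
by under [X in _ + X]eq_bigr do rewrite mulNr; rewrite sumrN subrr.
Qed.

(** Taking the trace forces [in] and [out] to have the same image, so only the
    partitions with [in] and [out] in one block contribute. *)
Lemma gm_inj_trace (g : gmonomial K) : exists D : seq (star_test_graph K),
  forall N (A : K -> 'M[R[i]]_N), ntr (gm_eval A g) = \sum_(T <- D) inj_trace A T.
Proof.
pose ok (r : {ffun vert g -> vert g}) := (kernel_rep r == r) && (r (gm_out g) == r (gm_in g)).
exists [seq quot_test r | r <- enum ok] => N A.
rewrite ntr_gm_eval big_map big_enum /= -mulr_sumr; congr (_ * _).
rewrite -(kernel_sum A (fun r => r (gm_out g) == r (gm_in g))).
by apply: eq_bigl => phi; rewrite kernel_rep_eq.
Qed.

Lemma gp_inj_trace (g : gpoly R K) : exists D : seq (R[i] * star_test_graph K),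
  forall N (A : K -> 'M[R[i]]_N), ntr (gp_eval A g) = \sum_(t <- D) t.1 * inj_trace A t.2.
Proof.
elim: g => [|[c m] g [D DE]].
  by exists [::] => N A; rewrite ntr_gp_eval !big_nil.
have [E EE] := gm_inj_trace m.
exists ([seq (c, T) | T <- E] ++ D) => N A.
rewrite ntr_gp_eval big_cons -ntr_gp_eval DE EE big_cat big_map /= mulr_sumr.
by [].
Qed.

End Moebius.

(** * Words as graph monomials *)

Section Words.
Context (R : realType) (K : Type).

(** Multiplication on the left by a letter: a new output vertex [None] is attached
    to the former output by an edge carrying the letter. *)
Definition extend_graph (g : gmonomial K) (x : K * bool) : lgraph K :=
  @LGraph K (option (vert g)) (option (edge g))
    (fun e => if e is Some e then Some (src e) else Some (gm_out g))
    (fun e => if e is Some e then Some (tgt e) else None)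
    (fun e => if e is Some e then lab e else x.1)
    (fun e => if e is Some e then star e else x.2).

Lemma extend_connected (g : gmonomial K) x : connected (extend_graph g x).
Proof.
have /connectedP[_ cg] := tg_connected g.
have S u v : connect (@adjacent K (extend_graph g x)) (Some u) (Some v).
  apply: (adjacent_connect (f := Some)) (cg u v).
    exact: (@adjacent_connect_sym _ (extend_graph g x)).
  by move=> e; apply: connect1; exact: (@adjacent_edge _ (extend_graph g x) (Some e)).
have O v : connect (@adjacent K (extend_graph g x)) (Some v) None.
  apply: connect_trans (S v (gm_out g)) _; apply: connect1.
  exact: (@adjacent_edge _ (extend_graph g x) None).
apply/connectedP; split; first by exists None.
move=> [u|] [v|]; [exact: S | exact: O | | exact: connect0].
by rewrite (@adjacent_connect_sym _ (extend_graph g x)); exact: O.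
Qed.

Definition extend (g : gmonomial K) (x : K * bool) : gmonomial K :=
  @GMonomial K (StarTestGraph (extend_connected g x)) (Some (gm_in g)) None.

Lemma sum_ffun_option (M : nmodType) (V : finType) (S : finType)
    (Q : pred {ffun option V -> S}) (F : {ffun option V -> S} -> M) :
  \sum_(phi | Q phi) F phi =
  \sum_(a : S) \sum_(psi : {ffun V -> S} | Q [ffun o => if o is Some v then psi v else a])
     F [ffun o => if o is Some v then psi v else a].
Proof.
rewrite pair_big_dep /=.
pose h (z : S * {ffun V -> S}) : {ffun option V -> S} :=
  [ffun o => if o is Some v then z.2 v else z.1].
rewrite (reindex h) //=.
exists (fun phi => (phi None, [ffun v => phi (Some v)])) => [[a psi] _|phi _].
  by congr (_, _); rewrite ?ffunE //; apply/ffunP => v; rewrite !ffunE.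
by apply/ffunP => -[v|]; rewrite !ffunE.
Qed.

Lemma gm_eval_extend N (A : K -> 'M[R[i]]_N) g x :
  gm_eval A (extend g x) = mx_star x.2 (A x.1) *m gm_eval A g.
Proof.
apply/matrixP => i k; rewrite !mxE sum_ffun_option (bigD1 i) //=.
rewrite [X in _ + X]big1 ?addr0; last first.
  move=> a ai; rewrite big_pred0 // => psi; rewrite ffunE /=.
  by rewrite (negPf ai).
under [RHS]eq_bigr do rewrite mxE mulr_sumr.
rewrite (partition_big (fun psi : {ffun vert g -> 'I_N} => psi (gm_out g)) xpredT) //=.
apply: eq_bigr => j _; apply: eq_big => [psi|psi /andP[_ /eqP pj]].
  by rewrite !ffunE eqxx /= andbC.
rewrite /weight (bigD1 None) //= !ffunE pj; congr (_ * _).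
rewrite (reindex_omap Some id) /=; last by case.
apply: eq_big => [e|e _]; first by rewrite eqxx.
by rewrite !ffunE.
Qed.

Lemma unit_connected : connected (@LGraph K unit void
  (of_void _) (of_void _) (of_void _) (of_void _)).
Proof.
by apply/connectedP; split; [exists tt | case; case; exact: connect0].
Qed.

Definition unit_monomial : gmonomial K := @GMonomial K (StarTestGraph unit_connected) tt tt.

Lemma gm_eval_unit N (A : K -> 'M[R[i]]_N) : gm_eval A unit_monomial = 1%:M.
Proof.
apply/matrixP => i k; rewrite !mxE.
case: (eqVneq i k) => [<-|ik]; last first.
  rewrite big_pred0 // => psi /=; apply: contra_neqF ik => /andP[/eqP <- /eqP <-] //.
rewrite (big_pred1 ([ffun=> i])) => [|psi /=].
  by rewrite /weight big1 //= => -[].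
rewrite andbb; apply/eqP/eqP => [E|->]; last by rewrite ffunE.
by apply/ffunP => -[]; rewrite ffunE.
Qed.

Lemma word_monomial (w : seq (K * bool)) : exists g : gmonomial K,
  forall N (A : K -> 'M[R[i]]_N),
    \big[mulmx/1%:M]_(x <- w) mx_star x.2 (A x.1) = gm_eval A g.
Proof.
elim: w => [|x w [g gE]].
  by exists unit_monomial => N A; rewrite big_nil gm_eval_unit.
by exists (extend g x) => N A; rewrite big_cons gE gm_eval_extend.
Qed.

Lemma ncpoly_gpoly (p : ncpoly R K) : exists g : gpoly R K,
  forall N (A : K -> 'M[R[i]]_N), nc_eval A p = gp_eval A g.
Proof.
elim: p => [|[c w] p [g gE]].
  by exists [::] => N A; rewrite /nc_eval /gp_eval !big_nil.
have [m mE] := word_monomial w.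
exists ((c, m) :: g) => N A; have := gE N A.
by rewrite /nc_eval /gp_eval !big_cons /= mE => ->.
Qed.

End Words.

(** * Decompositions into connected components *)

Lemma bij_inj_surj (A B : Type) (f : A -> B) :
  injective f -> (forall y, exists x, f x = y) -> bijective f.
Proof.
move=> fI /choice[g gK]; exists g => // x; apply: fI; exact: gK.
Qed.

Lemma big_prod_fprod (R : comPzSemiRingType) (I : finType) (T_ : I -> finType)
    (F : forall i, T_ i -> R) :
  \prod_i \sum_(j : T_ i) F i j = \sum_(t : fprod T_) \prod_i F i (t i).
Proof.
transitivity (\sum_(t : fprod T_) \prod_(i in I) [ffun x => F i x] (t i)); last first.
  by apply: eq_bigr => t _; apply: eq_bigr => i _; rewrite ffunE.
rewrite (@big_fprod _ 0 1 _ +%R I T_ (fun i => [ffun x => F i x])).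
have E := bigA_distr_big_dep (zero := 0) (one := 1) (times := *%R) (plus := +%R)
  (tagged_with (fun x => T_ x)) (fun i => untag 0 [ffun x => F i x]).
rewrite -E; apply: eq_bigr => i _.
rewrite -(@big_tag _ 0 +%R I T_ (fun i => [ffun x => F i x])).
by apply: eq_bigr => j _; rewrite ffunE.
Qed.

Section Decomposition.
Variable K : Type.

(** [T] is the disjoint union of the connected graphs [G i], up to renaming of
    vertices and edges.  Allowing any model of the components makes it
    unnecessary to compare the components of quotients, of restrictions and of
    disjoint unions with subgraphs of one fixed graph.  As the [G i] are
    connected, the cardinal of [I] is the number of components of [T]. *)
Record decomposition (T : lgraph K) (I : finType) (G : I -> star_test_graph K) :=
  Decomposition {
    dec_v : {i : I & vert (G i)} -> vert T;
    dec_e : {i : I & edge (G i)} -> edge T;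
    dec_v_bij : bijective dec_v;
    dec_e_bij : bijective dec_e;
    dec_src : forall i (e : edge (G i)),
      src (dec_e (existT _ i e)) = dec_v (existT _ i (src e));
    dec_tgt : forall i (e : edge (G i)),
      tgt (dec_e (existT _ i e)) = dec_v (existT _ i (tgt e));
    dec_lab : forall i (e : edge (G i)), lab (dec_e (existT _ i e)) = lab e;
    dec_star : forall i (e : edge (G i)), star (dec_e (existT _ i e)) = star e }.

Section Theory.
Variables (T : lgraph K) (I : finType) (G : I -> star_test_graph K).
Variable D : decomposition T G.

Lemma dec_index_ex (v : vert T) : exists i, exists x, dec_v D (existT _ i x) = v.
Proof. by have [g _ gK] := dec_v_bij D; case E: (g v) => [i x]; exists i, x; rewrite -E. Qed.

Definition dec_index (v : vert T) : I := sval (cid (dec_index_ex v)).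

Lemma dec_indexP (v : vert T) : exists x, dec_v D (existT _ (dec_index v) x) = v.
Proof. exact: svalP (cid (dec_index_ex v)). Qed.

Lemma dec_indexE i x : dec_index (dec_v D (existT _ i x)) = i.
Proof.
have [y] := dec_indexP (dec_v D (existT _ i x)).
by move/(bij_inj (dec_v_bij D)) => /(congr1 tag).
Qed.

Lemma dec_index_connect u v : connect (@adjacent K T) u v -> dec_index u = dec_index v.
Proof.
have h e : dec_index (src e) = dec_index (tgt e).
  have [g _ gK] := dec_e_bij D; rewrite -(gK e); case: (g e) => i x.
  by rewrite dec_src dec_tgt !dec_indexE.
move=> /connectP[p + ->]; elim: p u => //= x p IH u /andP[/adjacentP[e He] /IH <-].
by case: He => -[<- <-].
Qed.

Lemma dec_connect i x y :
  connect (@adjacent K T) (dec_v D (existT _ i x)) (dec_v D (existT _ i y)).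
Proof.
have /connectedP[_ /(_ x y)] := tg_connected (G i).
apply: (adjacent_connect (f := fun x => dec_v D (existT _ i x))).
  exact: adjacent_connect_sym.
by move=> e; rewrite -dec_src -dec_tgt; apply: connect1; exact: adjacent_edge.
Qed.

Lemma dec_index_eq u v : (dec_index u == dec_index v) = connect (@adjacent K T) u v.
Proof.
apply/eqP/idP => [E|]; last exact: dec_index_connect.
have [x] := dec_indexP u; have [y] := dec_indexP v.
move: (dec_index u) (dec_index v) E x y => i _ <- x y <- <-; exact: dec_connect.
Qed.

Lemma dec_index_surj i : exists v, dec_index v = i.
Proof. by exists (dec_v D (existT _ i (connected_vertex (G i)))); rewrite dec_indexE. Qed.

Definition fiber_inj (S : eqType) (f : vert T -> S) :=
  [forall u, forall v, (f u == f v) ==> (dec_index u == dec_index v) ==> (u == v)].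

Lemma fiber_injP (S : eqType) (f : vert T -> S) :
  reflect (forall u v, f u = f v -> dec_index u = dec_index v -> u = v) (fiber_inj f).
Proof.
apply: (iffP forallP) => [h u v fuv iuv|h u].
  move/forallP: (h u) => /(_ v)/implyP; rewrite fuv eqxx => /(_ isT)/implyP.
  by rewrite iuv eqxx => /(_ isT)/eqP.
by apply/forallP => v; do 2!(apply/implyP => /eqP ?); apply/eqP; exact: h.
Qed.

Lemma fiber_inj_kernel_rep (S : eqType) (f : vert T -> S) : fiber_inj (kernel_rep f) = fiber_inj f.
Proof.
by apply/fiber_injP/fiber_injP => h u v /eqP fuv; apply: h;
  apply/eqP; rewrite ?kernel_rep_eq // -kernel_rep_eq.
Qed.

(** Choosing an injective map on each component is choosing a map that is
    injective on each component. *)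
Lemma prod_inj_sum (R : realType) (N : nat) (A : K -> 'M[R[i]]_N) :
  \prod_i inj_sum A (G i) =
  \sum_(phi : {ffun vert T -> 'I_N} | fiber_inj phi) weight A phi.
Proof.
pose T_ i : finType := {ffun vert (G i) -> 'I_N}.
pose F i (psi : T_ i) : R[i] := if injectiveb psi then weight A psi else 0.
transitivity (\prod_i \sum_(psi : T_ i) F i psi).
  by apply: eq_bigr => i _; rewrite -big_mkcond.
rewrite big_prod_fprod [RHS]big_mkcond /=.
have [g gK Kg] := dec_v_bij D.
pose h (phi : {ffun vert T -> 'I_N}) : fprod T_ :=
  [fprod i => [ffun x => phi (dec_v D (existT _ i x))]].
pose h' (t : fprod T_) : {ffun vert T -> 'I_N} :=
  [ffun v => t (tag (g v)) (tagged (g v))].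
rewrite (reindex h) /=; last first.
  exists h' => [phi _|t _].
    apply/ffunP => v; rewrite !ffunE fprodE ffunE -[in RHS](Kg v).
    by case: (g v).
  apply/fprodP => i; rewrite fprodE; apply/ffunP => x.
  by rewrite !ffunE gK.
apply: eq_bigr => phi _; case: (boolP (fiber_inj phi)) => [/fiber_injP pI|/fiber_injP pI].
  have -> : weight A phi = \prod_i \prod_(e : edge (G i))
      mx_star (star e) (A (lab e)) (phi (dec_v D (existT _ i (tgt e))))
        (phi (dec_v D (existT _ i (src e)))).
    rewrite sig_big_dep /= /weight (reindex (dec_e D)); last exact: onW_bij (dec_e_bij D).
    by apply: eq_bigr => -[i e] _ /=; rewrite dec_src dec_tgt dec_lab dec_star.
  apply: eq_bigr => i _; rewrite /F ifT.
    by apply: eq_bigr => e _; rewrite fprodE !ffunE.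
  apply/injectiveP => x y; rewrite fprodE !ffunE => /pI; rewrite !dec_indexE => /(_ erefl).
  by move/(bij_inj (dec_v_bij D))/eqP; rewrite eq_Tagged => /eqP.
(* a map that is not injective on some component contributes 0 on the left *)
have [i ni] : exists i, ~~ injectiveb (h phi i).
  apply: contrapT => /forallNP hI; apply: pI => u v.
  have [x <-] := dec_indexP u; have [y <-] := dec_indexP v.
  rewrite !dec_indexE => puv E.
  move: (dec_index u) (dec_index v) E x y puv => i _ <- x y puv.
  congr (dec_v _ (existT _ _ _)).
  have [/injectiveP|/hI []] := boolP (injectiveb (h phi i)); apply.
  by rewrite fprodE !ffunE.
by rewrite (bigD1 i) //= /F (negPf ni) mul0r.
Qed.

End Theory.

(** Components are sent onto those of the quotient, and two of them are merged:
    two points identified by [r] lie in different components. *)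
Lemma card_dec_quot (T : lgraph K) (I I' : finType) (G : I -> star_test_graph K)
    (r : {ffun vert T -> vert T}) (G' : I' -> star_test_graph K)
    (D : decomposition T G) (D' : decomposition (quot r) G') :
  kernel_rep r == r -> fiber_inj D r -> r != [ffun v => v] -> (#|I'| < #|I|)%N.
Proof.
move=> /eqP rE /fiber_injP rI rid.
pose f i := dec_index D' (qproj r (dec_v D (existT _ i (connected_vertex (G i))))).
have fE v : f (dec_index D v) = dec_index D' (qproj r v).
  apply: dec_index_connect; apply: quot_connect.
  by rewrite -(dec_index_eq D) dec_indexE.
have fS i' : exists i, f i = i'.
  have [w <-] := dec_index_surj D' i'; have [v ->] := qproj_surj w.
  by exists (dec_index D v).
have fI : ~ injective f.
  move=> fI; move/negP: rid; apply; rewrite -{1}rE kernel_rep_id; apply/injectiveP => u v ruv.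
  apply: rI => //; apply: fI; rewrite !fE; congr dec_index; exact: val_inj.
have imf : #|codom f| = #|I'|.
  by apply: eq_card => i'; rewrite [RHS]inE; apply/codomP; have [i <-] := fS i'; exists i.
rewrite -imf ltn_neqAle (leq_image_card f I) andbT.
by apply/negP => /image_injP h; apply: fI => i j; exact: h.
Qed.

Definition self_decomposition (T : star_test_graph K) : @decomposition T unit (fun=> T).
Proof.
refine (@Decomposition T unit (fun=> T) (fun x => tagged x) (fun x => tagged x) _ _ _ _ _ _) => //.
  by exists (fun x => existT (fun=> vert T) tt x) => // -[[] x].
by exists (fun x => existT (fun=> edge T) tt x) => // -[[] x].
Defined.

Definition dunion (I : finType) (T : I -> lgraph K) : lgraph K :=
  @LGraph K {i & vert (T i)} {i & edge (T i)}
    (fun e => existT _ (tag e) (src (tagged e)))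
    (fun e => existT _ (tag e) (tgt (tagged e)))
    (fun e => lab (tagged e)) (fun e => star (tagged e)).

Definition dunion_decomposition (I : finType) (T : I -> star_test_graph K) :
  decomposition (dunion T) T.
Proof.
by refine (@Decomposition (dunion T) I T (fun x => x) (fun x => x) _ _ _ _ _ _) => //;
  exists id.
Defined.

Definition restr (T : lgraph K) (p : pred K) : lgraph K :=
  @LGraph K (vert T) {e : edge T | p (lab e)} (fun e => src (val e)) (fun e => tgt (val e))
    (fun e => lab (val e)) (fun e => star (val e)).

(** A component of a disjoint union is a component of one of the summands, hence
    the index type of pairs: this is what makes counts additive and limits
    multiplicative over disjoint unions. *)
Definition restr_dunion_decomposition (I : finType) (T : I -> lgraph K) (p : pred K)
    (J : I -> finType) (G : forall i, J i -> star_test_graph K)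
    (D : forall i, decomposition (restr (T i) p) (G i)) :
  decomposition (restr (dunion T) p) (fun x : {i & J i} => G (tag x) (tagged x)).
Proof.
refine (@Decomposition (restr (dunion T) p) {i & J i} (fun x => G (tag x) (tagged x))
  (fun z => existT _ (tag (tag z)) (dec_v (D (tag (tag z))) (existT _ (tagged (tag z)) (tagged z))))
  (fun z => exist _ (existT _ (tag (tag z))
      (val (dec_e (D (tag (tag z))) (existT _ (tagged (tag z)) (tagged z)))))
      (valP (dec_e (D (tag (tag z))) (existT _ (tagged (tag z)) (tagged z)))))
  _ _ _ _ _ _).
- apply: bij_inj_surj.
    move=> [[i j] x] [[i' j'] x'] /= E.
    have ii := congr1 tag E; rewrite /= in ii; case: _ / ii j' x' E => j' x' /eqP.
    rewrite eq_Tagged => /eqP/(bij_inj (dec_v_bij (D i))) E'.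
    have jj := congr1 tag E'; rewrite /= in jj; case: _ / jj x' E' => x' /eqP.
    by rewrite eq_Tagged => /eqP /= ->.
  move=> [i v]; have [g _ gK] := dec_v_bij (D i); case E: (g v) => [j x].
  by exists (existT _ (existT _ i j) x); rewrite /= -E gK.
- apply: bij_inj_surj.
    move=> [[i j] x] [[i' j'] x'] /= /(congr1 val) /= E.
    have ii := congr1 tag E; rewrite /= in ii; case: _ / ii j' x' E => j' x' /eqP.
    rewrite eq_Tagged => /eqP/val_inj/(bij_inj (dec_e_bij (D i))) E'.
    have jj := congr1 tag E'; rewrite /= in jj; case: _ / jj x' E' => x' /eqP.
    by rewrite eq_Tagged => /eqP /= ->.
  move=> [[i e] pe]; have [g _ gK] := dec_e_bij (D i).
  case E: (g (exist _ e pe)) => [j x].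
  by exists (existT _ (existT _ i j) x); apply: val_inj; rewrite /= -E gK.
- by move=> [i j] e; congr (existT _ _ _); exact: (dec_src (D i)).
- by move=> [i j] e; congr (existT _ _ _); exact: (dec_tgt (D i)).
- by move=> [i j] e; exact: (dec_lab (D i)).
- by move=> [i j] e; exact: (dec_star (D i)).
Defined.

End Decomposition.

(** * Spanning forests and cycles *)

Definition acyclic (V : finType) (e : rel V) : Prop :=
  forall p : seq V, ucycle e p -> (size p <= 2)%N.

Lemma ucycle_neighbors (V : finType) (e : rel V) (p : seq V) (x : V) :
  symmetric e -> ucycle e p -> (2 < size p)%N -> x \in p ->
  exists y z, [/\ y \in p, z \in p, y != z, e x y & e x z].
Proof.
move=> se cp sp xp; have [i q E] := rot_to xp.
have mq y : (y \in p) = (y \in x :: q) by rewrite -E mem_rot.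
move: sp; rewrite -(size_rot i) E /=.
have : ucycle e (x :: q) by rewrite -E rot_ucycle.
case: q mq {E} => [|y q] mq //; elim/last_ind: q mq => [|q z _] mq //.
move=> /andP[/= /andP[exy]]; rewrite rcons_path last_rcons => /andP[_ ezx].
case/and3P=> _; rewrite mem_rcons inE negb_or => /andP[yz _] _ _.
exists y, z; split=> //; last by rewrite se.
- by rewrite mq !inE eqxx orbT.
- by rewrite mq !inE mem_rcons inE eqxx !orbT.
Qed.

Section SpanningForest.
Variables (W : finType) (e : rel W).
Hypothesis se : symmetric e.

Let ce : connect_sym e := sym_connect_sym se.

Let reach x n := [exists t : n.-tuple W, path e x t && (last x t == fingraph.root e x)].

Let reach_ex x : exists n, reach x n.
Proof.
have /connectP[p pp lp] := connect_root e x.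
by exists (size p); apply/existsP; exists (in_tuple p); rewrite /= pp -lp eqxx.
Qed.

Let dist x := ex_minn (reach_ex x).

Let dist_min x p : path e x p -> last x p = fingraph.root e x -> (dist x <= size p)%N.
Proof.
move=> pp lp; rewrite /dist; case: ex_minnP => n _; apply.
by apply/existsP; exists (in_tuple p); rewrite /= pp lp eqxx.
Qed.

Let closer x := [pick y | e x y && (dist y < dist x)%N].
Let parent x := odflt x (closer x).

Let parentP x : fingraph.root e x != x -> e x (parent x) /\ (dist (parent x) < dist x)%N.
Proof.
move=> rx; rewrite /parent /closer; case: pickP => [y /andP[] //|no].
have : exists2 y, e x y & (dist y < dist x)%N.
  move: (erefl (dist x)); rewrite {1}/dist; case: ex_minnP => n /existsP[t /andP[pt /eqP lt]] _ En.
  case: t pt lt => -[|y p] /= /eqP st; first by move=> _ E; rewrite -E eqxx in rx.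
  case/andP=> exy py lp; exists y => //; rewrite -En -st ltnS; apply: dist_min => //.
  by rewrite lp; apply/(fingraph.rootP ce); exact: connect1.
by case=> y exy dy; have := no y; rewrite exy dy.
Qed.

Let forest u v := ((fingraph.root e u != u) && (v == parent u)) ||
  ((fingraph.root e v != v) && (u == parent v)).

Let dirs := [set z : W * W | e z.1 z.2]%SET.
Let nonroots := [set x : W | fingraph.root e x != x]%SET.
Let up := ((fun x => (x, parent x)) @: nonroots)%SET.
Let down := ((fun x => (parent x, x)) @: nonroots)%SET.

Let card_up : #|up| = #|nonroots|.
Proof. by apply: card_imset => x y []. Qed.

Let card_down : #|down| = #|nonroots|.
Proof. by apply: card_imset => x y []. Qed.

Let up_down : (up :&: down)%SET = finset.set0.
Proof.
apply/finset.setP => z; rewrite finset.in_setI finset.in_set0; apply/negP => /andP[].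
case/finset.imsetP=> x; rewrite finset.inE => /parentP[_ dx] ->.
case/finset.imsetP=> y; rewrite finset.inE => /parentP[_ dy] [E1 E2].
by move: dx dy; rewrite E2 -E1 => h1 h2; have := ltn_trans h1 h2; rewrite ltnn.
Qed.

Let sub_dirs : (up :|: down)%SET \subset dirs.
Proof.
rewrite finset.subUset; apply/andP; split; apply/fintype.subsetP => z /finset.imsetP[x + ->];
  by rewrite !finset.inE => /parentP[exy _] //=; rewrite se.
Qed.

Let card_forest : #|(up :|: down)%SET| = (2 * #|nonroots|)%N.
Proof.
by rewrite finset.cardsU up_down finset.cards0 subn0 card_up card_down mul2n addnn.
Qed.

Definition root_set := [set x : W | fingraph.root e x == x]%SET.
Definition arcs := dirs.

Let card_roots : (#|root_set| + #|nonroots| = #|W|)%N.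
Proof.
rewrite -(finset.cardsC root_set); congr addn; apply: eq_card => x.
by rewrite !finset.inE.
Qed.

Let forestE u v : forest u v = ((u, v) \in (up :|: down)%SET).
Proof.
rewrite finset.inE; apply/orP/orP => -[].
- case/andP=> ru /eqP ->; left; apply/finset.imsetP; exists u; rewrite ?finset.inE //.
- case/andP=> ru /eqP ->; right; apply/finset.imsetP; exists v; rewrite ?finset.inE //.
- by case/finset.imsetP=> x; rewrite finset.inE => rx [-> ->]; left; rewrite rx eqxx.
- by case/finset.imsetP=> x; rewrite finset.inE => rx [-> ->]; right; rewrite rx eqxx.
Qed.

(** A vertex that is not the root of its component has an arc to a vertex closer
    to the root.  These arcs are pairwise distinct, and distinct from the
    reversed ones because the distance decreases along them. *)
Lemma leq_card_arcs : (2 * #|W| <= #|arcs| + 2 * #|root_set|)%N.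
Proof.
have := subset_leq_card sub_dirs; rewrite card_forest -card_roots /arcs.
by lia.
Qed.

Let full : (2 * #|W| = #|arcs| + 2 * #|root_set|)%N <-> forall u v, e u v -> forest u v.
Proof.
have cf := card_forest; have cr := card_roots; rewrite /arcs; split=> [E u v euv|h].
  have : (up :|: down)%SET == dirs.
    rewrite finset.eqEcard sub_dirs /= cf.
    by move/eqP: E; rewrite -cr mulnDr [X in _ == X]addnC eqn_add2l => /eqP ->.
  by move=> /eqP E'; rewrite forestE E' finset.inE.
suff E' : (up :|: down)%SET = dirs by rewrite -E' -cr cf mulnDr addnC.
apply/eqP; rewrite finset.eqEsubset sub_dirs /=; apply/fintype.subsetP => -[u v].
by rewrite -forestE finset.inE /=; exact: h.
Qed.

Let forest_root x : connect forest x (fingraph.root e x).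
Proof.
move: {2}(dist x).+1 (ltnSn (dist x)) => n; elim: n x => // n IH x dx.
case: (eqVneq (fingraph.root e x) x) => [->|rx]; first exact: connect0.
have [exy dy] := parentP rx.
have -> : fingraph.root e x = fingraph.root e (parent x).
  by apply/(fingraph.rootP ce); exact: connect1.
apply: connect_trans (IH _ _); last exact: leq_trans dy _.
by apply: connect1; rewrite /forest rx eqxx.
Qed.

(** Equality means that all the arcs belong to the spanning forest.  In that case
    no cycle is possible: a vertex of the cycle at maximal distance from the root
    has two neighbors on the cycle, both of which would be its parent.
    Conversely an arc outside the forest closes a cycle with the path of the
    forest that joins its ends. *)
Lemma card_arcs_acyclic : irreflexive e ->
  (2 * #|W| = #|arcs| + 2 * #|root_set|)%N <-> acyclic e.
Proof.
move=> ie; split=> [/full h p cp|ac].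
  case: leqP => // sp.
  have [x0 x0p] : exists x, x \in p by case: p cp sp => // x p; exists x; exact: mem_head.
  case: (@arg_maxnP _ x0 (mem p) dist x0p) => x xp xmax.
  have [y [z [yp zp yz exy exz]]] := ucycle_neighbors se cp sp xp.
  have par w : w \in p -> e x w -> w = parent x.
    move=> wp /h /orP[/andP[_ /eqP //]|/andP[rw /eqP xw]].
    have [_] := parentP rw; rewrite -xw ltnNge.
    by have := xmax w wp; rewrite /= => ->.
  by move: yz; rewrite (par y) // (par z) // eqxx.
apply/full => x y exy; case: (boolP (forest x y)) => // nxy.
have sf : connect_sym forest by apply: sym_connect_sym => u v; rewrite /forest orbC.
have : connect forest x y.
  apply: connect_trans (forest_root x) _; rewrite (_ : fingraph.root e x = fingraph.root e y).
    by rewrite sf; exact: forest_root.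
  by apply/(fingraph.rootP ce); exact: connect1.
case/connectP=> p0 pp0 ly; case: (shortenP pp0) ly => p pp up' _ ly.
have fe u v : forest u v -> e u v.
  by rewrite forestE => /(fintype.subsetP sub_dirs); rewrite finset.inE.
have := ac (x :: p); rewrite /ucycle up' /= andbT rcons_path (sub_path fe pp) /= -ly se exy.
move=> /(_ isT); rewrite ltnS; case: p pp up' ly => [|z [|t p]] //=.
  by move=> _ _ E; rewrite E ie in exy.
by rewrite andbT => xz _ E; rewrite E xz in nxy.
Qed.

End SpanningForest.

(** * Colored components *)

Section Pieces.
Variables (K : Type) (T : lgraph K) (p : pred K).

Definition padj : rel (vert T) := @adjacent K (restr T p).

Lemma padj_csym : connect_sym padj.
Proof. exact: (@adjacent_connect_sym K (restr T p)). Qed.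

Lemma padj_edge (e : edge T) : p (lab e) -> padj (src e) (tgt e).
Proof. by move=> pe; apply: (@adjacent_edge K (restr T p) (exist _ e pe)). Qed.

Lemma padjP u v : reflect (exists2 e : edge T, p (lab e) &
    (src e = u /\ tgt e = v) \/ (src e = v /\ tgt e = u)) (padj u v).
Proof.
apply: (iffP (@adjacentP K (restr T p) u v)) => [[[e pe] He]|[e pe He]].
  by exists e.
by exists (exist _ e pe).
Qed.

(** The pieces are the connected components of [restr T p]; they are built as
    subgraphs of [T] in order to be compared with its colored components. *)
Definition piece_vset (s : vert T) : {set vert T} := [set u | connect padj s u]%SET.
Definition piece_eset (s : vert T) : {set edge T} :=
  [set e | p (lab e) && connect padj s (src e)]%SET.

Lemma piece_closed s : subgraph_closed (piece_vset s, piece_eset s).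
Proof.
apply/forall_inP => e /=; rewrite !finset.inE => /andP[pe se].
by rewrite se /=; apply: connect_trans se _; exact/connect1/padj_edge.
Qed.

Definition piece (s : vert T) : subgraph T := exist _ (_, _) (piece_closed s).

Lemma piece_subV s u : (u \in subV (piece s)) = connect padj s u.
Proof. by rewrite finset.inE. Qed.

Lemma piece_subE s e : (e \in subE (piece s)) = p (lab e) && connect padj s (src e).
Proof. by rewrite finset.inE. Qed.

Lemma eq_piece s s' : connect padj s s' -> piece s = piece s'.
Proof.
move=> ss; apply: val_inj => /=; congr (_, _); apply/finset.setP => u;
  by rewrite !finset.inE (same_connect padj_csym ss).
Qed.

Lemma piece_connected s : connected (sub_lgraph (piece s)).
Proof.
have ms : s \in subV (piece s) by rewrite piece_subV connect0.
have conn (u : vert T) (Hu : u \in subV (piece s)) :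
    connect (@adjacent K (sub_lgraph (piece s))) (exist _ s ms) (exist _ u Hu).
  have := Hu; rewrite piece_subV => /connectP[q pq lq].
  elim/last_ind: q u Hu pq lq => [|q w IH] u Hu.
    by move=> _ E; rewrite (_ : exist _ u Hu = exist _ s ms) ?connect0 //; exact: val_inj.
  rewrite rcons_path last_rcons => /andP[pq qw] E; rewrite -{}E in qw.
  have Hl : last s q \in subV (piece s).
    by rewrite piece_subV; apply/connectP; exists q.
  apply: connect_trans (IH _ Hl pq erefl) _; apply: connect1.
  have /padjP[e pe He] := qw.
  have eE : e \in subE (piece s).
    rewrite piece_subE pe /=; case: He => -[-> _]; first by rewrite -piece_subV.
    by rewrite -piece_subV.
  apply/adjacentP; exists (exist _ e eE) => /=.
  by case: He => -[h1 h2]; [left|right]; split; apply: val_inj.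
apply/connectedP; split; first by exists (exist _ s ms).
move=> [u Hu] [v Hv]; apply: connect_trans (conn v Hv).
by rewrite adjacent_connect_sym; exact: conn.
Qed.

Definition piece_test s : star_test_graph K := StarTestGraph (piece_connected s).

Definition piece_roots := {s : vert T | fingraph.root padj s == s}.

Definition piece_decomposition :
  decomposition (restr T p) (fun s : piece_roots => piece_test (val s)).
Proof.
refine (@Decomposition K (restr T p) piece_roots (fun s => piece_test (val s))
  (fun x => val (tagged x))
  (fun x => exist _ (val (tagged x))
     (proj1 (andP (etrans (esym (piece_subE (val (tag x)) (val (tagged x)))) (valP (tagged x))))))
  _ _ _ _ _ _) => //.
- apply: bij_inj_surj.
    move=> [s u] [s' u'] /= uu.
    have ss : s = s'.
      have := valP u; have := valP u'; rewrite /= !piece_subV -uu => h' h.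
      apply: val_inj; rewrite -(eqP (valP s)) -(eqP (valP s')).
      apply/(fingraph.rootP padj_csym); apply: connect_trans h _.
      by rewrite padj_csym.
    by case: _ / ss u' uu => u' uu; congr existT; exact: val_inj.
  move=> u; pose s := fingraph.root padj u.
  have rs : fingraph.root padj s == s by rewrite root_root //; exact: padj_csym.
  have su : u \in subV (piece s) by rewrite piece_subV padj_csym connect_root.
  by exists (existT _ (exist _ s rs) (exist _ u su)).
- apply: bij_inj_surj.
    move=> [s e] [s' e'] /= /(congr1 val) /= ee.
    have ss : s = s'.
      have := valP e; have := valP e'; rewrite /= !piece_subE -ee => /andP[_ h'] /andP[_ h].
      apply: val_inj; rewrite -(eqP (valP s)) -(eqP (valP s')).
      apply/(fingraph.rootP padj_csym); apply: connect_trans h _.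
      by rewrite padj_csym.
    by case: _ / ss e' ee => e' ee; congr existT; exact: val_inj.
  move=> [e pe]; pose s := fingraph.root padj (src e).
  have rs : fingraph.root padj s == s by rewrite root_root //; exact: padj_csym.
  have su : e \in subE (piece s) by rewrite piece_subE pe padj_csym connect_root.
  by exists (existT _ (exist _ s rs) (exist _ e su)); apply: val_inj.
Defined.

Lemma piece_indexE v : val (dec_index piece_decomposition v) = fingraph.root padj v.
Proof.
have [x E] := dec_indexP piece_decomposition v.
move: (dec_index _ _) x E => s x; rewrite /= => E.
rewrite -(eqP (valP s)); apply/(fingraph.rootP padj_csym).
by have := valP x; rewrite /= piece_subV E.
Qed.

End Pieces.

Lemma decomposition_restrT (K : Type) (T : lgraph K) (I : finType)
    (G : I -> star_test_graph K) :
  decomposition (restr T xpredT) G -> decomposition T G.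
Proof.
case=> dv de bv be ds dt dl dst.
apply: (@Decomposition K T I G dv (fun x => val (de x))) => //.
apply: bij_inj_surj => [x y /val_inj/(bij_inj be) //|e].
have [g _ gK] := be; exists (g (exist _ e isT)).
by rewrite gK.
Qed.

Lemma decomposition_exists (K : Type) (T : lgraph K) :
  exists (I : finType) (G : I -> star_test_graph K), inhabited (decomposition T G).
Proof.
exists (piece_roots T xpredT), (fun s => piece_test xpredT (val s)).
by constructor; apply: decomposition_restrT; exact: piece_decomposition.
Qed.

Section ColoredPieces.
Variables (L : nat) (J : 'I_L -> Type) (T : lgraph {l : 'I_L & J l}).

Definition of_color (l : 'I_L) : pred {l : 'I_L & J l} := fun k => tag k == l.

Local Notation cpiece l s := (@piece _ T (of_color l) s).

Lemma subgraph_connect (S : subgraph T) (l : 'I_L) u v :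
  connected (sub_lgraph S) -> (forall e, e \in subE S -> tag (lab e) == l) ->
  u \in subV S -> v \in subV S -> connect (@padj _ T (of_color l)) u v.
Proof.
move=> /connectedP[_ cS] mS Hu Hv.
have := cS (exist _ u Hu) (exist _ v Hv).
apply: (adjacent_connect (f := fun x : vert (sub_lgraph S) => val x)).
  exact: padj_csym.
by move=> [e He]; apply/connect1/padj_edge; exact: mS.
Qed.

Lemma sub_le_piece (S : subgraph T) (l : 'I_L) v :
  connected (sub_lgraph S) -> (forall e, e \in subE S -> tag (lab e) == l) ->
  v \in subV S -> sub_le S (cpiece l v).
Proof.
move=> cS mS Hv; apply/andP; split; apply/fintype.subsetP.
  by move=> u Hu; rewrite piece_subV; exact: subgraph_connect cS mS Hv Hu.
move=> e He; rewrite piece_subE; apply/andP; split; first exact: mS.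
apply: subgraph_connect cS mS Hv _.
by have /forall_inP/(_ _ He)/andP[] := valP S.
Qed.

Lemma sub_le_anti (S S' : subgraph T) : sub_le S S' -> sub_le S' S -> S = S'.
Proof.
case: S S' => [[A B] H] [[A' B'] H']; rewrite /sub_le /subV /subE /=.
case/andP=> h1 h2 /andP[h3 h4]; apply: val_inj => /=.
by congr (_, _); apply/eqP; rewrite finset.eqEsubset ?h1 ?h2.
Qed.

Lemma piece_colored l v : subE (cpiece l v) != finset.set0 -> colored_subgraph (cpiece l v).
Proof.
move=> n0; rewrite /colored_subgraph piece_connected n0 /=.
apply/existsP; exists l; apply/forall_inP => e.
by rewrite piece_subE => /andP[].
Qed.

Lemma piece_CC l v : subE (cpiece l v) != finset.set0 -> cpiece l v \in CC T.
Proof.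
move=> n0; rewrite finset.inE piece_colored //=.
apply/forallP => S; apply/implyP => /andP[/and3P[cS _ /existsP[l' /forall_inP mS]] le].
have [e He] := finset.set0Pn _ n0.
have [leV leE] := andP le.
have El : l' = l.
  apply/eqP; rewrite eq_sym; move: He; move=> /[dup] /(fintype.subsetP leE)/mS /eqP <-.
  by rewrite piece_subE => /andP[/eqP -> _].
apply/eqP; apply: sub_le_anti le; apply: sub_le_piece => //.
  by move=> x /mS; rewrite El.
by apply: (fintype.subsetP leV); rewrite piece_subV connect0.
Qed.

(** Any of the edges of a colored component gives its color and a vertex that
    generates it. *)
Lemma CC_piece (S : subgraph T) : S \in CC T ->
  exists l e, e \in subE S /\ tag (lab e) = l /\ S = cpiece l (src e).
Proof.
rewrite finset.inE => /andP[cS /forallP maxS].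
have /and3P[coS n0 /existsP[l /forall_inP mS]] := cS.
have [e He] := finset.set0Pn _ n0.
have Hse : src e \in subV S by have /forall_inP/(_ _ He)/andP[] := valP S.
exists l, e; split=> //; split; first exact/eqP/mS.
have le : sub_le S (cpiece l (src e)) by exact: sub_le_piece.
have /implyP := maxS (cpiece l (src e)); rewrite le andbT => h.
apply/esym/eqP; apply: h; apply: piece_colored; apply/finset.set0Pn; exists e.
by rewrite piece_subE connect0 andbT; exact: mS.
Qed.

Lemma CC_root (S : subgraph T) : S \in CC T ->
  exists x : {l : 'I_L & piece_roots T (of_color l)},
    S = cpiece (tag x) (val (tagged x)).
Proof.
move=> /CC_piece[l [e [He [_ ->]]]].
pose s := fingraph.root (@padj _ T (of_color l)) (src e).
have rs : fingraph.root (@padj _ T (of_color l)) s == s.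
  by rewrite root_root //; exact: padj_csym.
exists (existT _ l (exist _ s rs)); apply: eq_piece.
exact: connect_root.
Qed.

(** An edge of the piece gives the color, and then a vertex that gives the root. *)
Lemma piece_root_inj (x y : {l : 'I_L & piece_roots T (of_color l)}) :
  cpiece (tag x) (val (tagged x)) = cpiece (tag y) (val (tagged y)) ->
  subE (cpiece (tag x) (val (tagged x))) != finset.set0 -> x = y.
Proof.
case: x y => [l s] [l' s'] /= E /finset.set0Pn[e He].
have He' := He; rewrite E in He'.
move: He He'; rewrite !piece_subE => /andP[/eqP le se] /andP[/eqP le' se'].
have ll : l = l' by rewrite -le -le'.
case: _ / ll s' E se' {le'} => s' E se'; congr existT; apply: val_inj.
rewrite -(eqP (valP s)) -(eqP (valP s')); apply/(fingraph.rootP (@padj_csym _ _ _)).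
by apply: connect_trans se _; rewrite padj_csym.
Qed.

Lemma piece_edge_of_connect l u v : u != v -> connect (@padj _ T (of_color l)) u v ->
  subE (cpiece l u) != finset.set0.
Proof.
move=> uv /connectP[[|x q] /=]; first by move=> _ E; rewrite E eqxx in uv.
case/andP=> /[dup] ux /padjP[e pe He] _ _; apply/finset.set0Pn; exists e.
rewrite piece_subE pe /=; case: He => -[-> _]; first exact: connect0.
exact: connect1.
Qed.

Definition CC_inj_root (S : {S : subgraph T | S \in CC T}) := sval (cid (CC_root (valP S))).

Lemma CC_inj_rootE S : val S = cpiece (tag (CC_inj_root S)) (val (tagged (CC_inj_root S))).
Proof. exact: svalP (cid (CC_root (valP S))). Qed.

Lemma CC_inj_root_inj : injective CC_inj_root.
Proof. by move=> S S' E; apply: val_inj; rewrite !CC_inj_rootE E. Qed.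

(** The colored components are the pieces having at least one edge; the other
    factors are 1. *)
Lemma prod_pieces (R : comPzRingType) (f : subgraph T -> R) :
  (forall l s, subE (cpiece l s) = finset.set0 -> f (cpiece l s) = 1) ->
  \prod_(l < L) \prod_(s : piece_roots T (of_color l)) f (cpiece l (val s)) =
  \prod_(S : {S : subgraph T | S \in CC T}) f (val S).
Proof.
move=> f1; rewrite sig_big_dep /=.
rewrite (bigID (mem (codom CC_inj_root))) /= [X in _ * X]big1 ?mulr1; last first.
  move=> x /negP nx; apply: f1; apply/eqP; apply/negP => /negP n0; apply: nx.
  have xCC := piece_CC n0.
  pose S : {S : subgraph T | S \in CC T} := exist (fun S => S \in CC T) _ xCC.
  apply/codomP; exists S; apply: piece_root_inj => //.
  exact: (CC_inj_rootE S).
rewrite (reindex_omap (op := *%R) CC_inj_root (fun x =>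
   insub (cpiece (tag x) (val (tagged x))))) /=; last first.
  move=> x /codomP[S ->]; rewrite -CC_inj_rootE valK /=; by [].
apply: eq_big => [S|S _]; last by rewrite -CC_inj_rootE.
by rewrite codom_f -CC_inj_rootE valK eqxx.
Qed.

End ColoredPieces.

(** * The incidence graph of the colored components *)

Section Incidence.
Variables (V : finType) (L : nat) (I : 'I_L -> finType) (q : forall l, V -> I l).

Definition incidence_vertex : finType := (V + {l : 'I_L & I l})%type.

(** In the application [x : {l : 'I_L & I l}] is a component of color [tag x], and
    [q l v] is the component of color [l] containing [v].  Since isolated vertices
    count as components, each vertex has exactly one neighbor of each color,
    whence the number of arcs. *)
Definition incidence : rel incidence_vertex := fun a b =>
  match a, b with
  | inl v, inr x | inr x, inl v => q (tag x) v == tagged x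
  | _, _ => false
  end.

Lemma incidence_sym : symmetric incidence.
Proof. by case=> [v|x] [w|y]. Qed.

Lemma incidence_irr : irreflexive incidence.
Proof. by case=> [v|x]. Qed.

Lemma card_incidence_vertex : #|incidence_vertex| = (#|V| + \sum_l #|I l|)%N.
Proof. by rewrite card_sum card_tagged sumnE big_map big_enum. Qed.

Lemma card_incidence_arcs : #|arcs incidence| = (2 * (#|V| * L))%N.
Proof.
have row v : (\sum_(x : {l : 'I_L & I l}) (q (tag x) v == tagged x) = L)%N.
  transitivity (\sum_l \sum_(i : I l) (q l v == i))%N.
    by rewrite sig_big_dep /=.
  rewrite (eq_bigr (fun=> 1%N)) ?sum1_card ?card_ord // => l _.
  by rewrite (bigD1 (q l v)) //= eqxx big1 ?addn0 // => i; rewrite eq_sym => /negPf ->.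
rewrite /arcs -sum1_card big_mkcond /=.
rewrite (eq_bigr (fun z => nat_of_bool (incidence z.1 z.2))); last first.
  by move=> z _; rewrite finset.inE; case: incidence.
rewrite -(pair_bigA _ (fun a b => nat_of_bool (incidence a b))) /=.
rewrite big_sumType /=.
under eq_bigr do rewrite big_sumType /= big1 // add0n row.
under [X in (_ + X)%N]eq_bigr do rewrite big_sumType /= [X in (_ + X)%N]big1 // addn0.
rewrite exchange_big /=; under [X in (_ + X)%N]eq_bigr do rewrite row.
by rewrite sum_nat_const addnn mul2n.
Qed.

End Incidence.

Section Excess.
Variables (L : nat) (J : 'I_L -> Type) (T : lgraph {l : 'I_L & J l}).
Local Notation K := {l : 'I_L & J l}.
Variables (I0 : finType) (G0 : I0 -> star_test_graph K) (D0 : decomposition T G0).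
Variables (I : 'I_L -> finType) (G : forall l, I l -> star_test_graph K)
  (D : forall l, decomposition (restr T (of_color l)) (@G l)).

Let q (l : 'I_L) (v : vert T) : I l := dec_index (D l) v.
Arguments q : clear implicits.
Local Notation inc := (incidence q).

Lemma incidence_connect u v : connect (@adjacent K T) u v -> connect inc (inl u) (inl v).
Proof.
apply: (adjacent_connect (f := inl)).
  exact/sym_connect_sym/incidence_sym.
move=> e; pose x := existT I (tag (lab e)) (q (tag (lab e)) (src e)).
apply: (@connect_trans _ _ (inr x)); apply: connect1; rewrite /= /q ?eqxx //.
rewrite dec_index_eq; apply: connect1; rewrite adjacent_sym.
by apply: (@padj_edge _ T (of_color (tag (lab e)))); rewrite /of_color.
Qed.

(** Every node of the incidence graph is joined to a vertex of [T], and vertices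
    connected in [T] are connected in the incidence graph. *)
Lemma card_incidence_roots : (#|root_set inc| <= #|I0|)%N.
Proof.
have ci : connect_sym inc by exact/sym_connect_sym/incidence_sym.
pose h i := fingraph.root inc (inl (dec_v D0 (existT _ i (connected_vertex (G0 i))))).
apply: leq_trans (leq_image_card h I0); apply: subset_leq_card.
apply/fintype.subsetP => w; rewrite finset.inE => /eqP rw.
have [v vw] : exists v, connect inc w (inl v).
  case: w {rw} => [v|[l i]]; first by exists v; exact: connect0.
  have [v vi] := dec_index_surj (D l) i; exists v; apply: connect1 => /=.
  by rewrite /q vi.
apply/codomP; exists (dec_index D0 v); rewrite /h -{1}rw; apply/(fingraph.rootP ci).
apply: connect_trans vw _; apply: incidence_connect.
by rewrite -(dec_index_eq D0) dec_indexE.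
Qed.

(** The spanning forest inequality in the incidence graph, which has at most as
    many connected components as [T]. *)
Lemma excess_ge0 : (\sum_l #|I l| + #|vert T| <= #|vert T| * L + #|I0|)%N.
Proof.
have := leq_card_arcs (incidence_sym q).
rewrite card_incidence_vertex card_incidence_arcs -mulnDr leq_pmul2l //.
rewrite addnC => h; apply: leq_trans h _.
by rewrite leq_add2l card_incidence_roots.
Qed.

Lemma excess_eq0 : #|I0| = 1%N ->
  ((\sum_l #|I l| + #|vert T| == #|vert T| * L + #|I0|)%N <-> acyclic inc).
Proof.
move=> I1.
have r1 : #|root_set inc| = 1%N.
  apply/eqP; rewrite eqn_leq -{1}I1 card_incidence_roots /=.
  have /card_gt0P[i0 _] : (0 < #|I0|)%N by rewrite I1.
  have ci : connect_sym inc by exact/sym_connect_sym/incidence_sym.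
  apply/card_gt0P.
  exists (fingraph.root inc (inl (dec_v D0 (existT _ i0 (connected_vertex (G0 i0)))))).
  by rewrite finset.inE root_root.
rewrite -(card_arcs_acyclic (incidence_sym q) (@incidence_irr _ _ _ q)).
rewrite card_incidence_vertex card_incidence_arcs r1 I1 -mulnDr.
split=> [/eqP <-|/eqP]; first by rewrite addnC.
by rewrite eqn_pmul2l // [X in _ -> X == _]addnC.
Qed.

End Excess.

Section GCCTree.
Variables (L : nat) (J : 'I_L -> Type) (T : star_test_graph {l : 'I_L & J l}).
Local Notation K := {l : 'I_L & J l}.

Let q (l : 'I_L) (v : vert T) := dec_index (piece_decomposition T (of_color l)) v.
Local Notation inc := (incidence q).

Let inc_piece l (s : piece_roots T (of_color l)) v :
  (q l v == s) = (v \in subV (piece (of_color l) (val s))).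
Proof.
rewrite -val_eqE /q piece_indexE piece_subV -{1}(eqP (valP s)).
rewrite (sameP eqP (fingraph.rootP (@padj_csym _ _ _))).
exact: padj_csym.
Qed.

Lemma shared_two (S S' : {S : subgraph T | S \in CC T}) v :
  v \in subV (val S) -> v \in subV (val S') -> S != S' -> shared v.
Proof.
move=> vS vS' SS; apply/card_gt1P; exists (val S), (val S').
split; last by rewrite val_eqE.
  by rewrite finset.in_set (valP S).
by rewrite finset.in_set (valP S').
Qed.

Lemma CC_link (S S' : {S : subgraph T | S \in CC T}) v :
  v \in subV (val S) -> v \in subV (val S') -> connect (@GCC L J T) (inl S) (inl S').
Proof.
move=> vS vS'; case: (eqVneq S S') => [->|SS]; first exact: connect0.
have sv := shared_two vS vS' SS.
apply: (@connect_trans _ _ (inr (exist _ v sv))); exact: connect1.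
Qed.

(** Along a path of [T], consecutive edges lie in one colored component or in two
    components that share the vertex between them. *)
Lemma GCC_connected (a b : GCC_vertex T) : connect (@GCC L J T) a b.
Proof.
have sg : symmetric (@GCC L J T) by case=> [S|v] [S'|w].
have cg := sym_connect_sym sg.
have conn u v : connect (@adjacent K T) u v -> forall S S' : {S : subgraph T | S \in CC T},
    u \in subV (val S) -> v \in subV (val S') -> connect (@GCC L J T) (inl S) (inl S').
  move=> /connectP[p + ->]; elim: p u => [|x p IH] u /=; first by move=> _ S S'; exact: CC_link.
  case/andP=> /adjacentP[e He] /IH{}IH S S' uS vS'.
  pose l := tag (lab e).
  have eS : e \in subE (piece (of_color l) (src e)).
    by rewrite piece_subE connect0 /of_color eqxx.
  have SC : piece (of_color l) (src e) \in CC T by apply: piece_CC; apply/finset.set0Pn; exists e.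
  pose S0 : {S : subgraph T | S \in CC T} := exist (fun S => S \in CC T) _ SC.
  have se0 : src e \in subV (val S0) by rewrite piece_subV connect0.
  have te0 : tgt e \in subV (val S0).
    by rewrite piece_subV; apply/connect1/padj_edge; rewrite /of_color.
  have [u0 x0] : u \in subV (val S0) /\ x \in subV (val S0) by case: He => -[<- <-].
  exact: connect_trans (CC_link uS u0) (IH _ _ x0 vS').
have toS (c : GCC_vertex T) : exists (S : {S : subgraph T | S \in CC T}) v, v \in subV (val S) /\
    connect (@GCC L J T) c (inl S).
  case: c => [S|[v sv]].
    have [l [e [He [_ _]]]] := CC_piece (valP S).
    exists S, (src e); split; last exact: connect0.
    by have /forall_inP/(_ _ He)/andP[] := valP (val S).
  have /card_gt1P[S [S' [+ _ _]]] := sv; rewrite finset.inE => /andP[SC vS].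
  exists (exist (fun S => S \in CC T) _ SC), v; split=> //; exact: connect1.
have [S [u [uS aS]]] := toS a; have [S' [v [vS bS]]] := toS b.
apply: connect_trans aS _; rewrite cg; apply: connect_trans bS _; rewrite cg.
have /connectedP[_ cT] := tg_connected T.
exact: conn (cT u v) _ _ uS vS.
Qed.

Let emb (a : GCC_vertex T) : incidence_vertex (vert T) (fun l => piece_roots T (of_color l)) :=
  match a with inl C => inr (CC_inj_root C) | inr v => inl (val v) end.

Let emb_inj : injective emb.
Proof.
case=> [S|v] [S'|w] //= [].
  by move=> /CC_inj_root_inj ->.
by move=> /val_inj ->.
Qed.

Let embE a b : inc (emb a) (emb b) = @GCC L J T a b.
Proof. by case: a b => [S|v] [S'|w] //=; rewrite inc_piece -CC_inj_rootE. Qed.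

(** The graph of colored components is an induced subgraph of the incidence
    graph, and contains all its cycles: a node of a cycle has two neighbors, so a
    component on a cycle has two vertices, hence an edge, and a vertex on a cycle
    belongs to two such components. *)
Lemma acyclic_GCC : acyclic inc <-> acyclic (@GCC L J T).
Proof.
have cycE p : ucycle inc (map emb p) = ucycle (@GCC L J T) p.
  rewrite /ucycle (map_inj_uniq emb_inj); congr (_ && _).
  by rewrite cycle_map; apply: eq_cycle => a b; exact: embE.
split=> ac p cp; first by have := ac (map emb p); rewrite cycE size_map; exact.
case: leqP => // sp.
(* it suffices to show that the cycle only visits the image of [emb] *)
have nb := ucycle_neighbors (incidence_sym q) cp sp.
have piece_in x : inr x \in p -> exists S, inr x = emb (inl S).
  move=> /nb[[u|y] [[v|z] [_ _ uv]]] //= /eqP qu /eqP qv.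
  have n0 : subE (piece (of_color (tag x)) (val (tagged x))) != finset.set0.
    (* the piece also starts at [u], which is joined to the other vertex [v] *)
    rewrite (@eq_piece _ _ _ _ u); last first.
      by rewrite -piece_subV -inc_piece qu.
    apply: (@piece_edge_of_connect _ _ _ _ u v); first by apply: contraNneq uv => ->.
    rewrite -(dec_index_eq (piece_decomposition T (of_color (tag x)))).
    by rewrite -/(q _ u) -/(q _ v) qu qv.
  have SC := piece_CC n0.
  exists (exist (fun S => S \in CC T) _ SC); congr inr; apply: piece_root_inj => //.
  exact: (CC_inj_rootE (exist (fun S => S \in CC T) _ SC)).
have all_in c : c \in p -> exists a, c = emb a.
  case: c => [v|x] cp'; last by have [S ->] := piece_in x cp'; exists (inl S).
  have [[u|y] [[w|z] [yp zp yz]]] := nb _ cp'; rewrite // => vy vz.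
  have [S ES] := piece_in _ yp; have [S' ES'] := piece_in _ zp.
  have vS : v \in subV (val S).
    by move: vy; rewrite ES /= inc_piece -CC_inj_rootE.
  have vS' : v \in subV (val S').
    by move: vz; rewrite ES' /= inc_piece -CC_inj_rootE.
  have sv : shared v.
    by apply: (shared_two vS vS'); apply: contraNneq yz => E; rewrite ES ES' E.
  by exists (inr (exist _ v sv)).
have [p' E] : exists p', p = map emb p'.
  elim: p {cp sp nb piece_in} all_in => [|c p IH] all_in; first by exists [::].
  have [a Ea] := all_in c (mem_head _ _).
  have [|p' Ep] := IH; first by move=> d dp; apply: all_in; rewrite inE dp orbT.
  by exists (a :: p'); rewrite Ea Ep.
by move: cp sp; rewrite E cycE size_map => /ac; case: ltnP.
Qed.

Lemma excess_is_tree :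
  (\sum_(l < L) #|{: piece_roots T (of_color l)}| + #|vert T| == #|vert T| * L + 1)%N =
  `[< is_tree (@GCC L J T) >].
Proof.
have cu : #|{: unit}| = 1%N by rewrite card_unit.
have := excess_eq0 (self_decomposition T) (fun l => piece_decomposition T (of_color l)) cu.
rewrite cu => h; apply/idP/asboolP => [/h/acyclic_GCC ac|[_ ac]].
  by split=> //; exact: GCC_connected.
by apply/h/acyclic_GCC.
Qed.

End GCCTree.

(** * Means of weights: permutation invariance and independence *)

Section MxStar.
Context (R : realType) (N : nat).

Lemma mx_starE (b : bool) (M : 'M[R[i]]_N) i j :
  mx_star b M i j = if b then Num.conj (M j i) else M i j.
Proof. by case: b; rewrite //= !mxE. Qed.

Lemma perm_conjE (s : 'S_N) (M : 'M[R[i]]_N) i j :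
  (perm_mx s *m M *m (perm_mx s) ^t* ) i j = M (s i) (s j).
Proof.
by rewrite tr_perm_mx map_perm_mx -col_permE -row_permE !mxE.
Qed.

End MxStar.

Section RandomWeight.
Context (R : realType) (d : measure_display) (Omega : measurableType d)
  (P : probability Omega R).
Variables (K : Type) (N : nat).

Lemma crandom_weight (T : lgraph K) (phi : {ffun vert T -> 'I_N}) :
  crandom (fun F : family_space R K N => weight (F : K -> 'M[R[i]]_N) phi).
Proof.
apply: crandom_prod => e.
rewrite [X in crandom X](_ : _ = fun F : family_space R K N => if star e
  then Num.conj ((F : K -> 'M[R[i]]_N) (lab e) (phi (src e)) (phi (tgt e)))
  else (F : K -> 'M[R[i]]_N) (lab e) (phi (tgt e)) (phi (src e))); last first.
  by apply/funext => F; rewrite mx_starE.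
by case: (star e); [apply: crandomJ|]; exact: crandom_entry.
Qed.

Variable A : Omega -> K -> 'M[R[i]]_N.
Hypothesis rA : random_family P A.

Lemma tame_weight (T : lgraph K) (phi : {ffun vert T -> 'I_N}) :
  tame P (fun w => weight (A w) phi).
Proof.
apply: tame_prod => e.
rewrite [X in tame P X](_ : _ = fun w => if star e
  then Num.conj (A w (lab e) (phi (src e)) (phi (tgt e)))
  else A w (lab e) (phi (tgt e)) (phi (src e))); last first.
  by apply/funext => w; rewrite mx_starE.
by case: (star e); [apply: tameJ|]; have [h1 h2] := rA (lab e) (phi (src e)) (phi (tgt e));
  have [h3 h4] := rA (lab e) (phi (tgt e)) (phi (src e)).
Qed.

Lemma tame_inj_sum (T : lgraph K) : tame P (fun w => inj_sum (A w) T).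
Proof. by apply: tame_sum => phi; exact: tame_weight. Qed.

Lemma tame_inj_trace (T : lgraph K) : tame P (fun w => inj_trace (A w) T).
Proof. by apply: tameM; [exact: tame_cst | exact: tame_inj_sum]. Qed.

Lemma cexpect_inj_sum (T : lgraph K) : cexpect P (fun w => inj_sum (A w) T) =
  \sum_(phi : {ffun vert T -> 'I_N} | injectiveb phi) cexpect P (fun w => weight (A w) phi).
Proof. by rewrite cexpect_sum // => phi; exact/tame_cintegrable/tame_weight. Qed.

(** Both images are completed to enumerations of all the indices, and the terms of
    the same rank are matched. *)
Lemma perm_extend (V : finType) (phi psi : {ffun V -> 'I_N}) :
  injective phi -> injective psi -> exists s : 'S_N, forall v, s (phi v) = psi v.
Proof.
move=> fI gI.
pose rest (f : {ffun V -> 'I_N}) := [seq i <- enum 'I_N | i \notin codom f].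
pose lst (f : {ffun V -> 'I_N}) := codom f ++ rest f.
have ul (f : {ffun V -> 'I_N}) : injective f -> uniq (lst f).
  move=> inf; rewrite cat_uniq; apply/and3P; split.
  - by rewrite map_inj_uniq ?enum_uniq.
  - by apply/hasPn => i; rewrite mem_filter => /andP[].
  - by rewrite filter_uniq // enum_uniq.
have ml (f : {ffun V -> 'I_N}) i : i \in lst f.
  by rewrite mem_cat mem_filter mem_enum; case: (i \in codom f).
have sl (f : {ffun V -> 'I_N}) : injective f -> size (lst f) = N.
  move=> inf; rewrite -[RHS]card_ord -(card_uniqP (ul f inf)).
  by apply: eq_card => i; rewrite ml.
case: N phi psi fI gI @rest @lst ul ml sl => [|n] f g fI gI rest lst ul ml sl.
  by exists 1%g => v; case: (f v).
pose h i := nth ord0 (lst g) (index i (lst f)).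
have hI : injective h.
  move=> i j /eqP; rewrite nth_uniq ?ul ?sl //.
  - by rewrite (inj_in_eq (@index_inj _ i (lst f))) ?ml // => /eqP.
  - by rewrite -{2}(sl f fI) index_mem.
  - by rewrite -{2}(sl f fI) index_mem.
exists (perm hI) => v; rewrite permE /h /lst.
have vV : v \in enum V by rewrite mem_enum.
rewrite index_cat codom_f nth_cat size_codom /codom /image_mem index_map //.
by rewrite cardE index_mem vV (nth_map v) ?index_mem // nth_index.
Qed.

End RandomWeight.

Section PermutationInvariance.
Context (R : realType) (d : measure_display) (Omega : measurableType d)
  (P : probability Omega R) (K : Type) (N : nat) (A : Omega -> K -> 'M[R[i]]_N).
Hypothesis rA : random_family P A.
Hypothesis permA : perm_invariant P A.

(** Conjugation by a permutation that carries [phi] to [psi] turns one weight into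
    the other. *)
Lemma cexpect_weight_perm (T : lgraph K) (phi psi : {ffun vert T -> 'I_N}) :
  injectiveb phi -> injectiveb psi ->
  cexpect P (fun w => weight (A w) phi) = cexpect P (fun w => weight (A w) psi).
Proof.
move=> /injectiveP phiI /injectiveP psiI; have [s sE] := perm_extend phiI psiI.
pose A' w k := perm_mx s *m A w k *m (perm_mx s) ^t*.
have A'E w k i j : A' w k i j = A w k (s i) (s j) by rewrite perm_conjE.
have rA' : random_family P A'.
  move=> k i j; have := rA k (s i) (s j).
  by rewrite (_ : (fun w => A' w k i j) = (fun w => A w k (s i) (s j))) //; apply/funext.
have wE w : weight (A' w) phi = weight (A w) psi.
  by apply: eq_bigr => e _; rewrite !mx_starE !A'E !sE.
rewrite -(eq_cexpect P wE).
apply: (@cexpect_same_law R K N _ _ P A A' (fun F => weight F phi)).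
- by move=> k i j; case: (rA k i j).
- by move=> k i j; case: (rA' k i j).
- exact: permA.
- exact: crandom_weight.
- exact/tame_cintegrable/tame_weight.
- exact/tame_cintegrable/tame_weight.
Qed.

End PermutationInvariance.

Section Colors.
Variables (L : nat) (J : 'I_L -> Type).
Local Notation K := {l : 'I_L & J l}.

Definition tag_cast (l : 'I_L) (k : K) (H : of_color l k) : J l :=
  eq_rect (tag k) J (tagged k) l (eqP H).

Lemma existT_cast (l : 'I_L) (k : K) (H : of_color l k) : existT J l (tag_cast H) = k.
Proof. by case: k H => l' j H; rewrite /tag_cast; case: _ / (eqP H). Qed.

Definition decolor (T : lgraph K) (l : 'I_L) : lgraph (J l) :=
  @LGraph (J l) (vert T) {e : edge T | of_color l (lab e)}
    (fun e => src (val e)) (fun e => tgt (val e))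
    (fun e => tag_cast (valP e)) (fun e => star (val e)).

Context (R : realType) (d : measure_display) (Omega : measurableType d)
  (P : probability Omega R) (N : nat) (A : forall l, Omega -> J l -> 'M[R[i]]_N).
Arguments A : clear implicits.
Hypothesis rA : forall l, random_family P (A l).
Local Notation AU := (union_family A).

Lemma random_family_union : random_family P AU.
Proof. by case=> l j a b; exact: (rA (l := l)). Qed.

Lemma weight_decolor (T : lgraph K) l (phi : {ffun vert T -> 'I_N}) w :
  weight (AU w) (phi : {ffun vert (restr T (of_color l)) -> 'I_N}) =
  weight (A l w) (phi : {ffun vert (decolor T l) -> 'I_N}).
Proof.
apply: eq_bigr => e _ /=; congr (mx_star _ _ _ _).
by rewrite -[in LHS](existT_cast (valP e)).
Qed.

Lemma weight_colors (T : lgraph K) (phi : {ffun vert T -> 'I_N}) w :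
  weight (AU w) phi =
  \prod_(l < L) weight (AU w) (phi : {ffun vert (restr T (of_color l)) -> 'I_N}).
Proof.
rewrite /weight (partition_big (fun e => tag (lab e)) xpredT) //=.
apply: eq_bigr => l _.
rewrite (reindex_omap (fun e : {e : edge T | of_color l (lab e)} => val e) insub) /=.
  by apply: eq_bigl => e; rewrite valK eqxx andbT; exact: (valP e).
by move=> e le; rewrite insubT.
Qed.

Hypothesis indA : independent_families P A.

Lemma cexpect_weight_colors (T : lgraph K) (phi : {ffun vert T -> 'I_N}) :
  cexpect P (fun w => weight (AU w) phi) =
  \prod_(l < L) cexpect P (fun w =>
     weight (AU w) (phi : {ffun vert (restr T (of_color l)) -> 'I_N})).
Proof.
rewrite (eq_cexpect P (fun w => weight_colors phi w)).
rewrite (@eq_cexpect _ _ _ _ _ (fun w =>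
  \prod_(l < L) weight (A l w) (phi : {ffun vert (decolor T l) -> 'I_N}))); last first.
  by move=> w; apply: eq_bigr => l _; exact: weight_decolor.
rewrite (@cexpect_indep R _ _ P L _ (fun l => family_space R (J l) N) (fun l => A l)
  (fun l F => weight F (phi : {ffun vert (decolor T l) -> 'I_N}))).
- by apply: eq_bigr => l _; apply: eq_cexpect => w; rewrite weight_decolor.
- by move=> l; apply: measurable_family => k i j; case: (rA k i j).
- by move=> B mB; exact: indA.
- by move=> l; exact: crandom_weight.
- by move=> l; apply/tame_cintegrable/tame_weight.
Qed.

Variable l0 : 'I_L.
Hypothesis permA : forall l, l != l0 -> perm_invariant P (A l).

Lemma cexpect_weight_color_permutation (T : lgraph K) l (phi psi : {ffun vert T -> 'I_N}) :
  l != l0 -> injectiveb phi -> injectiveb psi ->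
  cexpect P (fun w => weight (AU w) (phi : {ffun vert (restr T (of_color l)) -> 'I_N})) =
  cexpect P (fun w => weight (AU w) (psi : {ffun vert (restr T (of_color l)) -> 'I_N})).
Proof.
move=> ll0 phiI psiI.
rewrite (eq_cexpect P (fun w => weight_decolor l phi w)).
rewrite (eq_cexpect P (fun w => weight_decolor l psi w)).
exact: (cexpect_weight_perm (rA (l := l)) (permA ll0)).
Qed.

(** For all colors but [l0] the mean of the weight is the same for all injective
    maps, hence [N ^_ n] times this mean is the mean of the injective sum; for
    [l0] the sum over the maps is kept. *)
Lemma cexpect_inj_sum_colors (T : lgraph K) :
  (N ^_ #|vert T|)%:R ^+ L.-1 * cexpect P (fun w => inj_sum (AU w) T) =
  \prod_(l < L) cexpect P (fun w => inj_sum (AU w) (restr T (of_color l))).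
Proof.
have rU := random_family_union.
have sumE l : cexpect P (fun w => inj_sum (AU w) (restr T (of_color l))) =
    \sum_(phi : {ffun vert T -> 'I_N} | injectiveb phi)
       cexpect P (fun w => weight (AU w) (phi : {ffun vert (restr T (of_color l)) -> 'I_N})).
  exact: cexpect_inj_sum.
rewrite cexpect_inj_sum //.
case: (pickP (fun phi : {ffun vert T -> 'I_N} => injectiveb phi)) => [phi0 phi0I|no]; last first.
  rewrite big_pred0; last exact: no.
  by rewrite mulr0 (bigD1 l0) //= sumE [X in X * _]big_pred0 ?mul0r //; exact: no.
have cardE : #|[pred phi : {ffun vert T -> 'I_N} | injectiveb phi]| = (N ^_ #|vert T|)%N.
  by rewrite -[in RHS](card_ord N) -card_inj_ffuns; apply: eq_card => phi; rewrite finset.inE.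
rewrite [RHS](bigD1 l0) //= mulrC sumE mulr_suml mulr_suml.
apply: eq_bigr => phi phiI.
rewrite cexpect_weight_colors (bigD1 l0) //= -mulrA; congr (_ * _).
have -> : (N ^_ #|vert T|)%:R ^+ L.-1 = \prod_(l < L | l != l0) (N ^_ #|vert T|)%:R :> R[i].
  rewrite prodr_const; congr (_ ^+ _).
  by rewrite -[in LHS](card_ord L) -(cardC1 l0).
rewrite -big_split /=; apply: eq_bigr => l ll0.
rewrite sumE (eq_bigr (fun=> cexpect P (fun w =>
  weight (AU w) (phi : {ffun vert (restr T (of_color l)) -> 'I_N})))).
  by rewrite sumr_const -cardE mulr_natr.
by move=> psi psiI; exact: cexpect_weight_color_permutation.
Qed.

End Colors.

(** * Asymptotics of injective sums *)

Section MergeAsymptotics.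
Context (R : realType) (d : nat -> measure_display)
  (Omega : forall N, measurableType (d N))
  (P : forall N, probability (Omega N) R) (K : Type)
  (A : forall N, Omega N -> K -> 'M[R[i]]_N).
Arguments A : clear implicits.
Hypothesis rA : forall N, random_family (P N) (A N).

Definition mean_inj (T : lgraph K) (N : nat) : R[i] :=
  cexpect (P N) (fun w => inj_sum (A N w) T).

Definition scaled_mean (k : nat) (T : lgraph K) (N : nat) : R[i] :=
  N%:R^-1 ^+ k * mean_inj T N.

(** The default value 0 is taken only by graphs whose scaled means do not
    converge. *)
Definition tau_lim (T : lgraph K) : R[i] :=
  xget 0 [set l | ccvg (scaled_mean 1 T) l].

Lemma tau_limP (T : lgraph K) l : ccvg (scaled_mean 1 T) l -> tau_lim T = l.
Proof.
move=> Tl; rewrite /tau_lim; case: xgetP => [y _ yl|/(_ l)//].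
exact: ccvg_unique yl Tl.
Qed.

Lemma tauN0E (T : star_test_graph K) : tauN0 P A T = scaled_mean 1 T.
Proof.
apply/funext => N; rewrite /tauN0 /scaled_mean expr1 -cexpectZ //.
exact/tame_cintegrable/tame_inj_sum.
Qed.

Lemma scaled_mean_lt k k' T a : (k < k')%N -> ccvg (scaled_mean k T) a ->
  ccvg (scaled_mean k' T) 0.
Proof.
move=> kk Ta.
have x0 : ccvg (fun N => N%:R^-1 ^+ (k' - k) : R[i]) 0.
  have := @ccvgX R _ _ (k' - k)%N (@ccvg_inv R); rewrite expr0n subn_eq0 leqNgt kk.
  exact.
rewrite -[0](mul0r a); refine (ccvg_eq (ccvgM x0 Ta) _) => N.
by rewrite /scaled_mean mulrA -exprD subnK // ltnW.
Qed.

Definition converging (T : lgraph K) : Prop :=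
  exists (I : finType) (G : I -> star_test_graph K) (D : decomposition T G) (a : R[i]),
    ccvg (scaled_mean #|I| T) a.

Lemma cexpect_prod_inj (T : lgraph K) (I : finType) (G : I -> star_test_graph K)
    (D : decomposition T G) N :
  cexpect (P N) (fun w => \prod_i inj_trace (A N w) (G i)) =
  scaled_mean #|I| T N +
  \sum_(r : {ffun vert T -> vert T} | [&& kernel_rep r == r, fiber_inj D r & r != [ffun v => v]])
     scaled_mean #|I| (quot r) N.
Proof.
have D1 : fiber_inj D [ffun v : vert T => v].
  by apply/fiber_injP => u v; rewrite !ffunE.
rewrite (@eq_cexpect _ _ _ _ _ (fun w => N%:R^-1 ^+ #|I| *
  (inj_sum (A N w) T +
   \sum_(r : {ffun vert T -> vert T} | [&& kernel_rep r == r, fiber_inj D r & r != [ffun v => v]])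
     inj_sum (A N w) (quot r)))); last first.
  move=> w; rewrite -(kernel_sum_id _ (Q := fun r : {ffun vert T -> vert T} => fiber_inj D r)) //.
  under [X in _ * X]eq_bigl do rewrite fiber_inj_kernel_rep.
  rewrite -prod_inj_sum /inj_trace big_split /= prodr_const.
  by [].
have iq (T' : lgraph K) : cintegrable (P N) (fun w => inj_sum (A N w) T').
  exact/tame_cintegrable/tame_inj_sum.
rewrite cexpectZ; last by apply: cintegrableD => //; exact: cintegrable_sum.
rewrite cexpectD //; last exact: cintegrable_sum.
by rewrite [X in _ + X]cexpect_sum // mulrDr mulr_sumr.
Qed.

(** The difference consists of injective sums of graphs in which vertices of
    different components have been merged, and these have fewer components than
    [T]. *)
Lemma prod_vs_inj (T : lgraph K) (I : finType) (G : I -> star_test_graph K)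
    (D : decomposition T G) :
  (forall r : {ffun vert T -> vert T}, kernel_rep r == r -> fiber_inj D r ->
     r != [ffun v => v] -> converging (quot r)) ->
  ccvg (fun N => cexpect (P N) (fun w => \prod_i inj_trace (A N w) (G i))
                 - scaled_mean #|I| T N) 0.
Proof.
move=> cq.
have s0 : ccvg (fun N => \sum_(r : {ffun vert T -> vert T} |
    [&& kernel_rep r == r, fiber_inj D r & r != [ffun v => v]]) scaled_mean #|I| (quot r) N) 0.
  rewrite -[X in ccvg _ X](big1 (R := R[i]) (idx := 0) (op := +%R) (index_enum _)
    (fun r : {ffun vert T -> vert T} => [&& kernel_rep r == r, fiber_inj D r & r != [ffun v => v]])
    (fun=> 0)) //.
  apply: ccvg_sum => r /and3P[r1 r2 r3].
  have [I' [G' [D' [a Ha]]]] := cq r r1 r2 r3.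
  exact (scaled_mean_lt (card_dec_quot D' r1 r2 r3) Ha).
refine (ccvg_eq s0 _) => N.
by rewrite (cexpect_prod_inj D) addrC addKr.
Qed.

Section OneFamily.
Variable p : pred K.
Hypothesis D0 : forall (I : finType) (G : I -> star_test_graph K),
  (forall i (e : edge (G i)), p (lab e)) ->
  ccvg (fun N => cexpect (P N) (fun w => \prod_i inj_trace (A N w) (G i)))
       (\prod_i tau_lim (G i)).

(** The merged graphs, which have fewer vertices, are controlled by induction. *)
Lemma scaled_mean_components (T : lgraph K) (I : finType) (G : I -> star_test_graph K)
    (D : decomposition T G) :
  (forall e : edge T, p (lab e)) ->
  ccvg (scaled_mean #|I| T) (\prod_i tau_lim (G i)).
Proof.
have [n] := ubnP #|vert T|; elim: n T I G D => // n IH T I G D leTn pT.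
have pG i (e : edge (G i)) : p (lab e) by rewrite -(dec_lab D).
have cq (r : {ffun vert T -> vert T}) : kernel_rep r == r -> fiber_inj D r ->
    r != [ffun v => v] -> converging (quot r).
  move=> r1 r2 r3; have [I' [G' [D']]] := decomposition_exists (quot r).
  exists I', G', D', (\prod_i tau_lim (G' i)); apply: IH => //.
  exact: leq_trans (card_quot r1 r3) leTn.
have := ccvgD (D0 pG) (ccvgM (@ccvg_cst _ (-1)) (prod_vs_inj cq)).
rewrite mulr0 addr0 => h; refine (ccvg_eq h _) => N.
by rewrite mulN1r opprB addrC subrK.
Qed.

End OneFamily.

End MergeAsymptotics.

Section ColoredLimit.
Context (R : realType) (d : nat -> measure_display)
  (Omega : forall N, measurableType (d N))
  (P : forall N, probability (Omega N) R)
  (L : nat) (J : 'I_L -> Type)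
  (A : forall N (l : 'I_L), Omega N -> J l -> 'M[R[i]]_N).
Arguments A : clear implicits.
Hypothesis rA : forall N l, random_family (P N) (A N l).
Hypothesis indA : forall N, independent_families (P N) (A N).
Variable l0 : 'I_L.
Hypothesis permA : forall l, l != l0 -> forall N, perm_invariant (P N) (A N l).
Local Notation K := {l : 'I_L & J l}.
Let AU := fun N : nat => union_family (A N).
Arguments AU : clear implicits.
Local Notation tau := (tau_lim P AU).

Hypothesis D0 : forall (l : 'I_L) (I : finType) (G : I -> star_test_graph K),
  (forall i (e : edge (G i)), of_color l (lab e)) ->
  ccvg (fun N => cexpect (P N) (fun w => \prod_i inj_trace (AU N w) (G i)))
       (\prod_i tau (G i)).

Let rU N : random_family (P N) (AU N) := random_family_union (@rA N).

(** The power of [N] left over by [cexpect_inj_sum_colors] is [- k], where [k] is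
    nonnegative by [excess_ge0]. *)
Lemma scaled_mean_limit (T : lgraph K) (I : finType) (G : I -> star_test_graph K)
    (D : decomposition T G) (I' : 'I_L -> finType) (G' : forall l, I' l -> star_test_graph K)
    (D' : forall l, decomposition (restr T (of_color l)) (@G' l)) :
  ccvg (scaled_mean P AU #|I| T)
    ((\sum_l #|I' l| + #|vert T| == #|vert T| * L + #|I|)%N%:R *
     \prod_l \prod_(i : I' l) tau (G' l i)).
Proof.
set n := #|vert T|.
have le := excess_ge0 D D'.
set k := (n * L + #|I| - (\sum_l #|I' l| + n))%N.
have -> : (\sum_l #|I' l| + n == n * L + #|I|)%N = (k == 0)%N.
  by rewrite /k subn_eq0 eqn_leq le.
have L0 : (0 < L)%N by case: (L) l0 => [[]|].
have hk : ccvg (fun N => N%:R^-1 ^+ k : R[i]) (k == 0)%:R.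
  by have := @ccvgX R _ _ k (@ccvg_inv R); rewrite expr0n.
have hF : ccvg (fun N => ((N ^_ n)%:R * N%:R^-1 ^+ n : R[i])^-1 ^+ L.-1) 1.
  have := @ccvgX R _ _ L.-1 (ccvgV (oner_neq0 _) (@ccvg_ffact R n)).
  by rewrite invr1 expr1n.
have hl : ccvg (fun N => \prod_l scaled_mean P AU #|I' l| (restr T (of_color l)) N)
    (\prod_l \prod_(i : I' l) tau (G' l i)).
  apply: ccvg_prod => l.
  by apply: (scaled_mean_components rU (@D0 l) (D' l)) => e; exact: (valP e).
have := ccvgM hk (ccvgM hF hl); rewrite mul1r => h.
refine (ccvg_near h _); exists n.+1 => N nN.
have N0 : N%:R != 0 :> R[i] by rewrite pnatr_eq0 -lt0n (leq_trans _ nN).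
have F0 : (N ^_ n)%:R != 0 :> R[i] by rewrite pnatr_eq0 -lt0n ffact_gt0 ltnW.
have E := cexpect_inj_sum_colors (@rA N) (@indA N) (fun l ll0 => @permA l ll0 N) T.
rewrite /scaled_mean big_split /= -E -/n -/(mean_inj P AU T N).
rewrite -(big_morph _ (exprD (N%:R^-1 : R[i])) (expr0 _)).
rewrite [((_ * _)^-1) ^+ L.-1]exprVn exprMn -exprM.
(* the exponents of [N] on both sides agree *)
have e : (k + \sum_l #|I' l| = n * L.-1 + #|I|)%N.
  have : (n * L = n * L.-1 + n)%N by rewrite -mulnSr prednK.
  by move: le; rewrite /k -/n; lia.
have F'0 : (N ^_ n)%:R ^+ L.-1 != 0 :> R[i] by rewrite expf_neq0.
have y0 : (N%:R^-1 : R[i]) ^+ (n * L.-1) != 0 by rewrite expf_neq0 // invr_eq0.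
have ex := congr1 (fun j => (N%:R^-1 : R[i]) ^+ j) e; rewrite /= !exprD in ex.
move: (mean_inj _ _ _ _) ((N ^_ n)%:R ^+ L.-1) (_ ^+ (n * L.-1)) F'0 y0 ex => m F y F'0 y0 ex.
transitivity (N%:R^-1 ^+ k * N%:R^-1 ^+ (\sum_l #|I' l|) * m / y).
  by rewrite ex; field.
by field; rewrite y0 F'0.
Qed.

End ColoredLimit.

(** * The limiting traffic distribution *)

Lemma card_sigT_sum (I : finType) (J : I -> finType) :
  #|{: {i : I & J i}}| = (\sum_i #|J i|)%N.
Proof. by rewrite card_tagged sumnE big_map big_enum. Qed.

Section EdgelessGraph.
Context (R : realType) (d : nat -> measure_display)
  (Omega : forall N, measurableType (d N))
  (P : forall N, probability (Omega N) R) (K : Type)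
  (A : forall N, Omega N -> K -> 'M[R[i]]_N).

Lemma tau_lim_edgeless (T : lgraph K) : connected T -> (edge T -> False) ->
  tau_lim P A T = 1.
Proof.
move=> /connectedP[[v _] cT] noE; apply: tau_limP.
(* a connected graph without edges is a single vertex *)
have V1 : #|vert T| = 1%N.
  apply/eqP/fintype1P; exists v => u.
  case/connectP: (cT v u) => -[|x p] /=; first by move=> _ ->.
  by case/andP=> /adjacentP[e]; case: (noE e).
refine (ccvg_near (@ccvg_cst R 1) _); exists 1%N => N N0.
have N0' : N%:R != 0 :> R[i] by rewrite pnatr_eq0 -lt0n.
rewrite /scaled_mean /mean_inj expr1.
rewrite (@eq_cexpect _ _ _ _ _ (fun w => N%:R * 1)); last first.
  move=> w; rewrite mulr1 /inj_sum (eq_bigr (fun=> 1)).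
    by rewrite sumr_const -[X in _ = X%:R]ffactn1 -V1 -[in RHS](card_ord N)
      -card_inj_ffuns; congr (_ *+ _); apply: eq_card => phi; rewrite finset.inE.
  by move=> phi _; apply: big1 => e; case: (noE e).
by rewrite cexpectZ ?cexpect1 ?mulr1 ?mulVf //; apply/tame_cintegrable/tame_cst.
Qed.

End EdgelessGraph.

Section ProductLimit.
Context (R : realType) (d : nat -> measure_display)
  (Omega : forall N, measurableType (d N))
  (P : forall N, probability (Omega N) R)
  (L : nat) (J : 'I_L -> Type)
  (A : forall N (l : 'I_L), Omega N -> J l -> 'M[R[i]]_N).
Arguments A : clear implicits.
Hypothesis rA : forall N l, random_family (P N) (A N l).
Hypothesis indA : forall N, independent_families (P N) (A N).
Variable l0 : 'I_L.
Hypothesis permA : forall l, l != l0 -> forall N, perm_invariant (P N) (A N l).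
Local Notation K := {l : 'I_L & J l}.
Let AU := fun N : nat => union_family (A N).
Arguments AU : clear implicits.
Local Notation tau := (tau_lim P AU).

Hypothesis D0 : forall (l : 'I_L) (I : finType) (G : I -> star_test_graph K),
  (forall i (e : edge (G i)), of_color l (lab e)) ->
  ccvg (fun N => cexpect (P N) (fun w => \prod_i inj_trace (AU N w) (G i)))
       (\prod_i tau (G i)).

Let rU N : random_family (P N) (AU N) := random_family_union (@rA N).
Let limit := scaled_mean_limit rA indA permA D0.

(** The vanishing of the exponent for a connected graph. *)
Definition treelike (T : star_test_graph K) : bool :=
  (\sum_(l < L) #|{: piece_roots T (of_color l)}| + #|vert T| == #|vert T| * L + 1)%N.

Lemma cvg_scaled_mean_connected (T : star_test_graph K) : ccvg (scaled_mean P AU 1 T)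
  ((treelike T)%:R *
   \prod_l \prod_(s : piece_roots T (of_color l)) tau (piece_test (of_color l) (val s))).
Proof.
have := limit (self_decomposition T) (fun l => piece_decomposition T (of_color l)).
by rewrite card_unit.
Qed.

Lemma tauE (T : star_test_graph K) : tau T = (treelike T)%:R *
   \prod_l \prod_(s : piece_roots T (of_color l)) tau (piece_test (of_color l) (val s)).
Proof. exact: tau_limP (@cvg_scaled_mean_connected T). Qed.

Lemma cvg_tau (T : star_test_graph K) : ccvg (scaled_mean P AU 1 T) (tau T).
Proof. rewrite tauE; exact: cvg_scaled_mean_connected. Qed.

Lemma tau_GCC (T : star_test_graph K) : tau T =
  `[< is_tree (@GCC L J T) >]%:R *
  \prod_(S : {S : subgraph T | S \in CC T}) tau (CC_test_graph S).
Proof.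
rewrite tauE /treelike excess_is_tree; congr (_ * _).
apply: (prod_pieces (f := fun S : subgraph T => tau (sub_lgraph S))) => l s E.
apply: tau_lim_edgeless; first exact: piece_connected.
by case=> e; rewrite E finset.in_set0.
Qed.

(** Both sides of the equality are sums over the summands of the disjoint union,
    and the inequality of [excess_ge0] holds for each of them. *)
Lemma treelike_all (I : finType) (T : I -> star_test_graph K) :
  (\sum_(l < L) #|{: {i & piece_roots (T i) (of_color l)}}| + #|vert (dunion T)| ==
   #|vert (dunion T)| * L + #|I|)%N = [forall i, treelike (T i)].
Proof.
under eq_bigr do rewrite card_sigT_sum.
rewrite exchange_big /= card_sigT_sum -[#|I|]sum1_card big_distrl /= -!big_split /=.
have h i : (\sum_(l < L) #|{: piece_roots (T i) (of_color l)}| + #|vert (T i)| <=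
    #|vert (T i)| * L + 1 ?= iff treelike (T i))%N.
  have := excess_ge0 (self_decomposition (T i)) (fun l => piece_decomposition (T i) (of_color l)).
  by rewrite card_unit => le; split.
have [_ E] := leqif_sum (P := xpredT) (fun i _ => h i).
by rewrite E; apply: eq_forallb.
Qed.

(** The disjoint union of the graphs has them as components, so its injective sum
    is equivalent to the product. *)
Lemma cvg_prod_inj_trace (I : finType) (T : I -> star_test_graph K) :
  ccvg (fun N => cexpect (P N) (fun w => \prod_i inj_trace (AU N w) (T i)))
       (\prod_i tau (T i)).
Proof.
have cq (r : {ffun vert (dunion T) -> vert (dunion T)}) : kernel_rep r == r ->
    fiber_inj (dunion_decomposition T) r -> r != [ffun v => v] ->
    converging P AU (quot r).
  move=> _ _ _; have [I' [G' [D']]] := decomposition_exists (quot r).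
  exists I', G', D'; eexists.
  exact: (limit D' (fun l => piece_decomposition (quot r) (of_color l))).
have D' l := restr_dunion_decomposition
  (fun i => piece_decomposition (T i) (of_color l)).
have := ccvgD (prod_vs_inj rU cq) (limit (dunion_decomposition T) D').
rewrite add0r treelike_all /=.
have -> : \prod_i tau (T i) = [forall i, treelike (T i)]%:R *
    \prod_l \prod_(x : {i & piece_roots (T i) (of_color l)})
      tau (piece_test (of_color l) (val (tagged x))).
  under eq_bigr do rewrite tauE.
  rewrite big_split /=; congr (_ * _).
    case: (boolP [forall i, _]) => [/forallP h|].
      by rewrite big1 // => i _; rewrite h.
    by rewrite negb_forall => /existsP[i /negPf ni]; rewrite (bigD1 i) //= ni mul0r.
  rewrite exchange_big /=; apply: eq_bigr => l _.
  by rewrite sig_big_dep.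
move=> h; refine (ccvg_eq h _) => N.
by rewrite subrK.
Qed.

Let it (N : nat) (w : Omega N) (T : star_test_graph K) : R[i] := inj_trace (AU N w) T.

Lemma cvg_prod_seq (Ts : seq (star_test_graph K)) :
  ccvg (fun N => cexpect (P N) (fun w => \prod_(T <- Ts) it w T)) (\prod_(T <- Ts) tau T).
Proof.
case: Ts => [|T0 Ts].
  rewrite big_nil; refine (ccvg_eq (@ccvg_cst R 1) _) => N.
  by rewrite -[RHS](cexpect1 (P N)); apply: eq_cexpect => w; rewrite big_nil.
set s := T0 :: Ts; rewrite (big_nth T0) big_mkord.
refine (ccvg_eq (@cvg_prod_inj_trace _ (fun i : 'I_(size s) => nth T0 s i)) _) => N.
by apply: eq_cexpect => w; rewrite (big_nth T0) big_mkord.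
Qed.

(** Joint multilinearity, by expanding one factor at a time: [Ds] lists the factors
    that are still combinations, and [Ts] the graphs already chosen. *)
Lemma cvg_prod_lin (Ds : seq (seq (R[i] * star_test_graph K))) (Ts : seq (star_test_graph K)) :
  ccvg (fun N => cexpect (P N) (fun w => (\prod_(T <- Ts) it w T) *
          \prod_(D <- Ds) \sum_(t <- D) t.1 * it w t.2))
       ((\prod_(T <- Ts) tau T) * \prod_(D <- Ds) \sum_(t <- D) t.1 * tau t.2).
Proof.
have t_it N T : tame (P N) (fun w => it w T) by exact: tame_inj_trace.
have t_lin N (D : seq (R[i] * star_test_graph K)) :
    tame (P N) (fun w => \sum_(t <- D) t.1 * it w t.2).
  by apply: tame_sum => t; apply: tameM => //; exact: tame_cst.
elim: Ds Ts => [|D Ds IH] Ts.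
  rewrite big_nil mulr1; refine (ccvg_eq (@cvg_prod_seq Ts) _) => N.
  by apply: eq_cexpect => w; rewrite big_nil mulr1.
have -> : (\prod_(T <- Ts) tau T) * \prod_(D' <- D :: Ds) \sum_(t <- D') t.1 * tau t.2 =
    \sum_(t <- D) t.1 * ((\prod_(T <- t.2 :: Ts) tau T) *
       \prod_(D <- Ds) \sum_(t <- D) t.1 * tau t.2).
  rewrite big_cons mulrCA mulr_suml; apply: eq_bigr => t _.
  by rewrite big_cons !mulrA.
refine (ccvg_eq (ccvg_sum (fun t _ => ccvgM (@ccvg_cst _ t.1) (IH (t.2 :: Ts)))) _) => N.
have tame_term t : tame (P N) (fun w => (\prod_(T <- t :: Ts) it w T) *
    \prod_(D <- Ds) \sum_(t <- D) t.1 * it w t.2).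
  by apply: tameM; apply: tame_prod.
transitivity (\sum_(t <- D) cexpect (P N) (fun w => t.1 * ((\prod_(T <- t.2 :: Ts) it w T) *
    \prod_(D <- Ds) \sum_(t <- D) t.1 * it w t.2))); last first.
  by apply: eq_bigr => t _; rewrite cexpectZ //; exact: tame_cintegrable.
rewrite -cexpect_sum; last by move=> t; exact/cintegrableZ/tame_cintegrable.
apply: eq_cexpect => w.
rewrite big_cons mulrCA mulr_suml; apply: eq_bigr => t _.
by rewrite big_cons !mulrA.
Qed.

Lemma union_traffic_factorization : exists PhiU : gpoly R K -> R[i],
  cvg_traffic P AU PhiU /\ factorization P AU PhiU.
Proof.
have /choice[D DE] := @gp_inj_trace R K.
exists (fun g => \sum_(t <- D g) t.1 * tau t.2); split.
  move=> g; have := @cvg_prod_lin [:: D g] [::].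
  rewrite big_nil mul1r big_seq1 => h; refine (ccvg_eq h _) => N.
  by apply: eq_cexpect => w; rewrite DE big_nil mul1r big_seq1.
move=> k g _; have := @cvg_prod_lin [seq D (g r) | r <- enum 'I_k] [::].
rewrite big_nil mul1r big_map big_enum /= => h; refine (ccvg_eq h _) => N.
apply: eq_cexpect => w; rewrite big_nil mul1r big_map big_enum /=.
by apply: eq_bigr => r _; rewrite DE.
Qed.

End ProductLimit.

Section Marginal.
Variables (L : nat) (J : 'I_L -> Type).
Local Notation K := {l : 'I_L & J l}.

Lemma monochromatic_test_graph (T : star_test_graph K) (l : 'I_L) :
  (forall e : edge T, of_color l (lab e)) ->
  exists T' : star_test_graph (J l),
    forall (R : realType) (Omega : Type) N (A : forall l, Omega -> J l -> 'M[R[i]]_N) w,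
      inj_trace (union_family A w) T = inj_trace (A l w) T'.
Proof.
move=> lT.
exists (@StarTestGraph (J l) (@LGraph (J l) (vert T) (edge T) (@src _ T) (@tgt _ T)
  (fun e => tag_cast (lT e)) (@star _ T)) (tg_connected T)) => R Omega N A w.
congr (_ * _); apply: eq_bigr => phi _; apply: eq_bigr => e _ /=.
congr (mx_star _ _ _ _); by rewrite -[in LHS](existT_cast (lT e)).
Qed.

Context (R : realType) (d : nat -> measure_display)
  (Omega : forall N, measurableType (d N))
  (P : forall N, probability (Omega N) R)
  (A : forall N (l : 'I_L), Omega N -> J l -> 'M[R[i]]_N).
Arguments A : clear implicits.
Variable Phi : forall l : 'I_L, gpoly R (J l) -> R[i].
Hypothesis rA : forall N l, random_family (P N) (A N l).
Hypothesis A_cvg : forall l : 'I_L, cvg_traffic P (fun N => A N l) (@Phi l).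
Hypothesis A_fact : forall l : 'I_L, factorization P (fun N => A N l) (@Phi l).
Let AU := fun N : nat => union_family (A N).
Arguments AU : clear implicits.

(** Graphs of a single color are graphs in one family, for which injective traces
    are traces of graph polynomials; the assumptions on the family apply to
    these. *)
Lemma cvg_prod_marginal (l : 'I_L) (I : finType) (G : I -> star_test_graph K) :
  (forall i (e : edge (G i)), of_color l (lab e)) ->
  ccvg (fun N => cexpect (P N) (fun w => \prod_i inj_trace (AU N w) (G i)))
       (\prod_i tau_lim P AU (G i)).
Proof.
move=> lG.
have /choice[g gE] i : exists g : gpoly R (J l), forall N w,
    inj_trace (AU N w) (G i) = ntr (gp_eval (A N l w) g).
  have [T' TE] := monochromatic_test_graph (@lG i); have [g gE] := inj_trace_gpoly R T'.
  by exists g => N w; rewrite /AU TE gE.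
have tauE i : tau_lim P AU (G i) = Phi (g i).
  apply: tau_limP; rewrite -tauN0E; last by move=> N; exact: random_family_union.
  refine (ccvg_eq (@A_cvg l (g i)) _) => N.
  by apply: eq_cexpect => w; exact: gE.
under eq_bigr do rewrite tauE.
have h k (f : 'I_k -> gpoly R (J l)) : ccvg (fun N => cexpect (P N) (fun w =>
      \prod_(r < k) ntr (gp_eval (A N l w) (f r)))) (\prod_(r < k) Phi (f r)).
  case: k f => [|[|k]] f; last exact: (@A_fact l _ f isT).
    rewrite big_ord0; refine (ccvg_eq (@ccvg_cst R 1) _) => N.
    by rewrite -[RHS](cexpect1 (P N)); apply: eq_cexpect => w; rewrite big_ord0.
  rewrite big_ord1; refine (ccvg_eq (@A_cvg l (f ord0)) _) => N.
  by apply: eq_cexpect => w; rewrite big_ord1.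
have reE (F : I -> R[i]) : \prod_i F i = \prod_(r < #|I|) F (enum_val r).
  apply: (reindex (fun r : 'I_#|I| => enum_val r)).
  exact: onW_bij (@enum_val_bij I).
rewrite reE; refine (ccvg_eq (h _ (fun r => g (enum_val r))) _) => N.
apply: eq_cexpect => w.
by rewrite reE; apply: eq_bigr => r _; rewrite gE.
Qed.

End Marginal.

(** * Asymptotic traffic independence *)

Theorem theorem1p8 (R : realType) (d : nat -> measure_display)
    (Omega : forall N : nat, measurableType (d N))
    (P : forall N : nat, probability (Omega N) R)
    (L : nat) (J : 'I_L -> Type)
    (A : forall (N : nat) (l : 'I_L), Omega N -> J l -> 'M[R[i]]_N)
    (Phi : forall l : 'I_L, gpoly R (J l) -> R[i])
    (A_random : forall (N : nat) (l : 'I_L), random_family (P N) (A N l))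
    (A_indep : forall N : nat, independent_families (P N) (A N))
    (A_perm : exists l0 : 'I_L, forall l : 'I_L, l != l0 ->
       forall N : nat, perm_invariant (P N) (A N l))
    (A_cvg : forall l : 'I_L, cvg_traffic P (fun N => A N l) (Phi l))
    (A_fact : forall l : 'I_L, factorization P (fun N => A N l) (Phi l)) :
  let AU := fun N : nat => union_family (A N) in
  exists (PhiU : gpoly R {l : 'I_L & J l} -> R[i])
         (tau : star_test_graph {l : 'I_L & J l} -> R[i]),
    [/\ cvg_traffic P AU PhiU /\ cvg_star_distribution P AU,
        forall T : star_test_graph {l : 'I_L & J l}, ccvg (tauN0 P AU T) (tau T),
        forall (l : 'I_L) (T : star_test_graph (J l)),
          ccvg (tauN0 P (fun N => A N l) T)
               (tau (relabel_test (existT J l) T)),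
        forall T : star_test_graph {l : 'I_L & J l},
          tau T = `[< is_tree (@GCC L J T) >]%:R *
                  \prod_(S : {S : subgraph T | S \in CC T}) tau (CC_test_graph S) &
        factorization P AU PhiU].
Proof.
move=> AU; have [l0 permA] := A_perm.
have D0 := cvg_prod_marginal A_random A_cvg A_fact.
have [PhiU [cvgU factU]] := union_traffic_factorization A_random A_indep permA D0.
have rU N : random_family (P N) (AU N) by exact: random_family_union.
have cvg_tauN0 (T : star_test_graph {l : 'I_L & J l}) : ccvg (tauN0 P AU T) (tau_lim P AU T).
  by rewrite tauN0E //; exact: (cvg_tau A_random A_indep permA D0).
exists PhiU, (tau_lim P AU); split=> //.
- split=> // p; have [g gE] := ncpoly_gpoly p.
  exists (PhiU g); refine (ccvg_eq (@cvgU g) _) => N.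
  by apply: eq_cexpect => w; rewrite gE.
- by move=> l T; exact: (@cvg_tauN0 (relabel_test (existT J l) T)).
- by move=> T; exact: (tau_GCC A_random A_indep permA D0).
Qed.
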